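(* Let $k$ be an algebraically closed field of characteristic $0$ and let $H$ be a connected Hopf algebra over $k$. Then the following statements are equivalent: (I) $\operatorname{GKdim}H<\infty$; (II) $\operatorname{GKdim}\operatorname{gr}H<\infty$; (III) $\operatorname{gr}H$ is finitely generated as an algebra; (IV) $\operatorname{gr}H$ is isomorphic, as an algebra, to the polynomial ring over $k$ in $\ell$ variables for some $\ell\ge0$. In this case, $\operatorname{GKdim}H=\operatorname{GKdim}\operatorname{gr}H$, which is a non-negative integer.
   Context: A Hopf algebra is connected if its coradical (the sum of all its simple subcoalgebras) is one-dimensional. $\operatorname{gr}H=\bigoplus_{n\ge0}H_n/H_{n-1}$ (with $H_{-1}=0$) is the associated graded Hopf algebra of $H$ with respect to its coradical filtration $\{H_n\}$. $\operatorname{GKdim}$ denotes Gelfand–Kirillov dimension over $k$. *)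

(* Defs.v *)
From HB Require Import structures.
From mathcomp Require Import all_boot all_order all_algebra.
From mathcomp Require Import boolp classical_sets reals ereal sequences exp.
(* The notations of multinomials clash with those of mathcomp-analysis. *)
From mathcomp Require Import -(notations) freeg mpoly.

Set Implicit Arguments.
Unset Strict Implicit.
Unset Printing Implicit Defensive.

Import GRing.Theory.
Local Open Scope quotient_scope.
Local Open Scope ring_scope.

(* submodClosed does not inherit from zmodClosed, which quotients require. *)
Record subspace (k : fieldType) (V : lmodType k) := Subspace {
  subspace_pred :> {pred V};
  subspaceP : submod_closed subspace_pred
}.

HB.instance Definition _ (k : fieldType) (V : lmodType k) (W : subspace V) :=
  GRing.isSubmodClosed.Build k V (subspace_pred W) (subspaceP W).

Section Span.
Context {k : fieldType} {V : lmodType k}.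
Implicit Types (A : set V) (W : subspace V).

Definition lspan_pred A : {pred V} := fun v =>
  `[< forall W, (forall x, A x -> x \in W) -> v \in W >].

Lemma lspan_submod_closed A : submod_closed (lspan_pred A).
Proof.
split=> [|a u v /asboolP uA /asboolP vA].
  by apply/asboolP=> W _; rewrite rpred0.
by apply/asboolP=> W sW; rewrite rpredD ?rpredZ ?uA ?vA.
Qed.

Definition lspan A : subspace V := Subspace (lspan_submod_closed A).

Lemma mem_lspan A v : A v -> v \in lspan A.
Proof. by move=> Av; apply/asboolP=> W; apply. Qed.

Lemma lspan_sub A W : (forall x, A x -> x \in W) -> {subset lspan A <= W}.
Proof. by move=> sA v /asboolP; apply. Qed.

Lemma lspan_ind A (P : V -> Prop) :
    P 0 -> (forall a u v, P u -> P v -> P (a *: u + v)) ->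
    (forall x, A x -> P x) ->
  forall v, v \in lspan A -> P v.
Proof.
move=> P0 PD PA v vA.
have cP : submod_closed (fun v => `[< P v >] : bool).
  split; first exact/asboolP.
  by move=> a x y /asboolP Px /asboolP Py; apply/asboolP/PD.
apply/asboolP; apply: (@lspan_sub A (Subspace cP)) vA => x Ax.
exact/asboolP/PA.
Qed.

Definition has_dim (W : {pred V}) (d : nat) : Prop :=
  exists e : 'I_d -> V,
    (forall c : 'I_d -> k, \sum_i c i *: e i = 0 -> forall i, c i = 0) /\
    (forall v, v \in W <-> exists c : 'I_d -> k, v = \sum_i c i *: e i).

(* The junk value 0 is taken when W is not a finite-dimensional subspace. *)
Definition dimv (W : {pred V}) : nat := xget 0%N [set d | has_dim W d].

End Span.

Definition quotm (k : fieldType) (V : lmodType k) (W : subspace V) : Type :=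
  Quotient.quot W.

Section QuotientModule.
Context {k : fieldType} {V : lmodType k} (W : subspace V).

HB.instance Definition _ := Choice.on (quotm W).
HB.instance Definition _ := EqQuotient.on (quotm W).
HB.instance Definition _ := GRing.Zmodule.on (quotm W).
HB.instance Definition _ := ZmodQuotient.on (quotm W).

Lemma quotmW (P : quotm W -> Prop) :
  (forall y, P (\pi_(quotm W) y)) -> forall x, P x.
Proof. exact: quotW. Qed.

Lemma quotm_eq (x y : V) : (\pi_(quotm W) x == \pi_(quotm W) y) = (x - y \in W).
Proof. by rewrite piE. Qed.

Definition quotm_scale (a : k) (x : quotm W) : quotm W := \pi_(quotm W) (a *: repr x).

Lemma pi_quotm_scale a x :
  quotm_scale a (\pi_(quotm W) x) = \pi_(quotm W) (a *: x).
Proof.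
apply/eqP; rewrite quotm_eq -scalerBr rpredZ //.
by rewrite -quotm_eq reprK.
Qed.

Lemma quotm_scaleA a b x :
  quotm_scale a (quotm_scale b x) = quotm_scale (a * b) x.
Proof. by elim/quotmW: x => x; rewrite !pi_quotm_scale scalerA. Qed.

Lemma quotm_scale1 : left_id 1 quotm_scale.
Proof. by move=> x; elim/quotmW: x => x; rewrite pi_quotm_scale scale1r. Qed.

Lemma quotm_scaleDr : right_distributive quotm_scale +%R.
Proof.
move=> a x y; elim/quotmW: x => x; elim/quotmW: y => y.
by rewrite -(raddfD (\pi_(quotm W))) !pi_quotm_scale scalerDr raddfD.
Qed.

Lemma quotm_scaleDl x : {morph quotm_scale^~ x : a b / a + b}.
Proof.
by move=> a b; elim/quotmW: x => x; rewrite !pi_quotm_scale scalerDl raddfD.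
Qed.

HB.instance Definition _ := GRing.Zmodule_isLmodule.Build k (quotm W)
  quotm_scaleA quotm_scale1 quotm_scaleDr quotm_scaleDl.

Lemma pi_quotm_is_scalable : scalable (\pi_(quotm W)).
Proof. by move=> a x; rewrite -pi_quotm_scale. Qed.

HB.instance Definition _ :=
  GRing.isScalable.Build k V (quotm W) *:%R (\pi_(quotm W)) pi_quotm_is_scalable.

Lemma quotm_eq0 (x : V) : (\pi_(quotm W) x == 0) = (x \in W).
Proof. by rewrite -(raddf0 (\pi_(quotm W))) quotm_eq subr0. Qed.

End QuotientModule.

Section Tensor.
Context {k : fieldType} (U V : lmodType k).

Definition free_prod : Type := FreegDefs.type_of (Phant k) (Phant (U * V)).
HB.instance Definition _ := GRing.Lmodule.on free_prod.

Definition free_gen (u : U) (v : V) : free_prod := Freeg [:: (1, (u, v))].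

Definition bilinear_rel : set free_prod := [set t |
  (exists a u u' v, t = free_gen (a *: u + u') v
                        - (a *: free_gen u v + free_gen u' v)) \/
  (exists a u v v', t = free_gen u (a *: v + v')
                        - (a *: free_gen u v + free_gen u v'))].

Definition tensor : Type := quotm (lspan bilinear_rel).
HB.instance Definition _ := GRing.Lmodule.on tensor.

Definition tensor_pi (s : free_prod) : tensor :=
  \pi_(quotm (lspan bilinear_rel)) s.

Lemma tensor_pi_linear : linear tensor_pi.
Proof. by move=> a s t; rewrite /tensor_pi linearP. Qed.

Lemma tensorW (P : tensor -> Prop) :
  (forall s, P (tensor_pi s)) -> forall t, P t.
Proof. exact: quotmW. Qed.

Definition pure (u : U) (v : V) : tensor := tensor_pi (free_gen u v).

End Tensor.

Notation "u \ox v" := (pure u v) (at level 40, left associativity).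

Section TensorLift.
Context {k : fieldType} {U V W : lmodType k}.

(* For bilinear f, the linear map sending u \ox v to f u v; junk otherwise. *)
Definition tlift (f : U -> V -> W) (t : tensor U V) : W :=
  fglift (fun p : U * V => f p.1 p.2) (repr t).

Lemma pureDl a u u' (v : V) :
  (a *: u + u') \ox v = a *: (u \ox v) + u' \ox v :> tensor U V.
Proof.
apply/eqP; rewrite /pure -tensor_pi_linear quotm_eq; apply: mem_lspan.
by left; exists a, u, u', v.
Qed.

Lemma pureDr a (u : U) (v v' : V) :
  u \ox (a *: v + v') = a *: (u \ox v) + u \ox v' :> tensor U V.
Proof.
apply/eqP; rewrite /pure -tensor_pi_linear quotm_eq; apply: mem_lspan.
by right; exists a, u, v, v'.
Qed.

Lemma fglift_linear (f : U * V -> W) : linear (fglift f : free_prod U V -> W).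
Proof.
have fD : additive (fglift f : free_prod U V -> W) by apply: lift_is_additive.
pose F := HB.pack_for {additive free_prod U V -> W}
  (fglift f : free_prod U V -> W) (GRing.isZmodMorphism.Build _ _ _ fD).
have FE : (F : _ -> _) = fglift f by [].
move=> a s t; rewrite -FE raddfD; congr (_ + _).
have aE : a *: s = \sum_(x <- dom s) Freeg [:: (a * coeff x s, x)] by [].
rewrite aE (raddf_sum F) -[in RHS](freeg_sumE s) (raddf_sum F) scaler_sumr.
by apply: eq_bigr => i _; rewrite FE !liftU scalerA.
Qed.

Definition bilinear_map (f : U -> V -> W) : Prop :=
  (forall v, linear (f^~ v)) /\ (forall u, linear (f u)).

Lemma tlift_pi f : bilinear_map f -> forall s : free_prod U V,
  tlift f (tensor_pi s)
  = fglift (fun p : U * V => f p.1 p.2) s.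
Proof.
move=> [fl fr] s; rewrite /tlift; set g := fun p : U * V => _.
have gL := fglift_linear g.
have gU u v : fglift g (free_gen u v) = f u v by rewrite liftU scale1r.
have gB (x y : free_prod U V) : fglift g (x - y) = fglift g x - fglift g y.
  have -> : x - y = -1 *: y + x by rewrite scaleN1r addrC.
  by rewrite gL scaleN1r addrC.
apply/eqP; rewrite -subr_eq0 -gB.
have : repr (\pi_(quotm (lspan (@bilinear_rel k U V))) s) - s
       \in lspan (@bilinear_rel k U V).
  by rewrite -quotm_eq reprK.
move: (_ - s); apply: lspan_ind.
- by have := gB 0 0; rewrite !subrr => ->.
- by move=> a x y /eqP gx /eqP gy; rewrite gL gx gy scaler0 addr0.
by move=> x [[a [u [u' [v ->]]]]|[a [u [v [v' ->]]]]];
  rewrite gB gL !gU ?fl ?fr subrr.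
Qed.

Lemma tlift_pure f : bilinear_map f -> forall u v, tlift f (u \ox v) = f u v.
Proof. by move=> fB u v; rewrite /pure tlift_pi // liftU scale1r. Qed.

Lemma tlift_linear f : bilinear_map f -> linear (tlift f).
Proof.
move=> fB a s t.
move: s t; apply: (@tensorW k U V) => s; apply: (@tensorW k U V) => t.
rewrite -tensor_pi_linear !tlift_pi //; exact: fglift_linear.
Qed.

End TensorLift.

Lemma tensor_ind (k : fieldType) (U V : lmodType k) (P : tensor U V -> Prop) :
    P 0 -> (forall a s t, P s -> P t -> P (a *: s + t)) ->
    (forall u v, P (u \ox v)) ->
  forall t, P t.
Proof.
move=> P0 PD PU; apply: tensorW => s; rewrite -[s]freeg_sumE.
elim: (dom s) => [|p r IHr]; first by rewrite big_nil /tensor_pi raddf0.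
rewrite big_cons.
have -> : Freeg [:: (coeff p s, p)] =
          coeff p s *: free_gen p.1 p.2 :> free_prod U V.
  apply/eqP/freeg_eqP => q; rewrite coeffU.
  by rewrite coeffZ coeffU mul1r -surjective_pairing.
by rewrite tensor_pi_linear; apply: PD => //; apply: PU.
Qed.

Section TensorMaps.
Context {k : fieldType}.

Definition tmap (U V U' V' : lmodType k) (f : U -> U') (g : V -> V') :
  tensor U V -> tensor U' V' := tlift (fun u v => f u \ox g v).

Definition tassoc (U V W : lmodType k) :
    tensor (tensor U V) W -> tensor U (tensor V W) :=
  tlift (fun t w => tlift (fun u v => u \ox (v \ox w)) t).

Definition tmul (A : algType k) (s t : tensor A A) : tensor A A :=
  tlift (fun a b => tlift (fun c d => (a * c) \ox (b * d)) t) s.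

Definition tspan (V W : lmodType k) (D : {pred V}) (E : {pred W}) :
    subspace (tensor V W) :=
  lspan [set t | exists d e, [/\ d \in D, e \in E & t = d \ox e]].

End TensorMaps.

HB.mixin Record isCoalgebra (k : fieldType) C of GRing.Lmodule k C := {
  comul : C -> tensor C C;
  counit : C -> k;
  comul_linear : linear comul;
  counit_scalar : scalar counit;
  comulA : forall x, tassoc (tmap comul id (comul x)) = tmap id comul (comul x);
  counitl : forall x, tlift (fun a b => counit a *: b) (comul x) = x;
  counitr : forall x, tlift (fun a b => counit b *: a) (comul x) = x
}.

#[short(type="coalgType")]
HB.structure Definition Coalgebra (k : fieldType) :=
  {C of isCoalgebra k C & GRing.Lmodule k C}.

HB.mixin Record isBialgebra (k : fieldType) B
    of Coalgebra k B & GRing.Algebra k B := {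
  comul1 : comul (1 : B) = 1 \ox 1;
  comulM : forall x y : B, comul (x * y) = tmul (comul x) (comul y);
  counit1 : counit (1 : B) = 1;
  counitM : {morph (counit : B -> k) : x y / x * y}
}.

#[short(type="bialgType")]
HB.structure Definition Bialgebra (k : fieldType) :=
  {B of isBialgebra k B & Coalgebra k B & GRing.Algebra k B}.

HB.mixin Record isHopfAlgebra (k : fieldType) H of Bialgebra k H := {
  antipode : H -> H;
  antipode_linear : linear antipode;
  antipodel : forall x : H,
    tlift (fun a b => antipode a * b) (comul x) = counit x *: 1;
  antipoder : forall x : H,
    tlift (fun a b => a * antipode b) (comul x) = counit x *: 1
}.

#[short(type="hopfAlgType")]
HB.structure Definition HopfAlgebra (k : fieldType) :=
  {H of isHopfAlgebra k H & Bialgebra k H}.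

Section Coradical.
Context {k : fieldType} (C : coalgType k).

Definition subcoalgebra (D : subspace C) : Prop :=
  forall x, x \in D -> comul x \in tspan D D.

Definition simple_subcoalgebra (D : subspace C) : Prop :=
  [/\ subcoalgebra D,
      exists2 x, x \in D & x != 0
    & forall E : subspace C, subcoalgebra E -> {subset E <= D} ->
        (forall x, x \in E -> x = 0) \/ {subset D <= E}].

Definition coradical : subspace C :=
  lspan [set x | exists2 D, simple_subcoalgebra D & x \in D].

Definition wedge_pred (D E : subspace C) : {pred C} := fun x =>
  comul x \in lspan [set t | t \in tspan D predT \/ t \in tspan predT E].

Lemma wedge_submod_closed D E : submod_closed (wedge_pred D E).
Proof.
have c0 : comul (0 : C) = 0.
  have := comul_linear (-1) (0 : C) 0.
  by rewrite scaler0 addr0 scaleN1r addNr.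
pose W : subspace (tensor C C) :=
  lspan [set t | t \in tspan D predT \/ t \in tspan predT E].
have wE x : (x \in wedge_pred D E) = (comul x \in W) by [].
split=> [|a x y]; first by rewrite wE c0 rpred0.
by rewrite !wE => xW yW; rewrite comul_linear rpredD ?rpredZ.
Qed.

Definition wedge D E : subspace C := Subspace (wedge_submod_closed D E).

(* H_(n+1) is the preimage of H_0 (x) H + H (x) H_n under comultiplication. *)
Fixpoint coradical_fil (n : nat) : subspace C :=
  if n is m.+1 then wedge coradical (coradical_fil m) else coradical.

Definition connected_coalg : Prop := has_dim coradical 1.

End Coradical.

Record filtration (k : fieldType) (A : algType k) := Filtration {
  fil :> nat -> subspace A;
  filS : forall n, {subset fil n <= fil n.+1};
  fil1 : 1 \in fil 0;
  filM : forall m n x y, x \in fil m -> y \in fil n -> x * y \in fil (m + n)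
}.

Section AssociatedGraded.
Context {k : fieldType} {A : algType k} (F : filtration A).

(* F_(n-1), with the convention F_(-1) = 0 *)
Definition fil_pred (n : nat) : subspace A :=
  if n is m.+1 then F m else lspan set0.

(* F_n / F_(n-1) is regarded as a subspace of A / F_(n-1). *)
Definition gr_axiom (f : forall n, quotm (fil_pred n)) : Prop :=
  (exists N, forall n, (N <= n)%N -> f n = 0) /\
  (forall n, exists2 x, x \in F n & f n = \pi_(quotm (fil_pred n)) x).

Record gr : Type := Gr {
  gr_val :> forall n, quotm (fil_pred n);
  grP : gr_axiom gr_val
}.

HB.instance Definition _ := gen_eqMixin gr.
HB.instance Definition _ := gen_choiceMixin gr.

Lemma gr_eq (f g : gr) : (forall n, f n = g n) -> f = g.
Proof.
case: f g => [f fP] [g gP] /= fg.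
have fgE : f = g by apply: functional_extensionality_dep.
by move: fP; rewrite fgE => fP; congr Gr; apply: Prop_irrelevance.
Qed.

Local Notation "\pi[ n ] x" := (\pi_(quotm (fil_pred n)) x)
  (at level 10, x at level 9).

Lemma mem_fil_pred0 x : (x \in fil_pred 0) = (x == 0).
Proof.
apply/idP/eqP => [|->]; last exact: rpred0.
by move: x; apply: lspan_ind => // a u v -> ->; rewrite scaler0 addr0.
Qed.

Lemma fil_predW n : {subset fil_pred n <= F n}.
Proof.
by case: n => [|n] x; [rewrite mem_fil_pred0 => /eqP->; apply: rpred0|apply: filS].
Qed.

Lemma fil_predMl m n x y :
  x \in fil_pred m -> y \in F n -> x * y \in fil_pred (m + n).
Proof.
case: m => [|m]; last exact: filM.
by rewrite mem_fil_pred0 => /eqP-> _; rewrite mul0r rpred0.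
Qed.

Lemma fil_predMr m n x y :
  x \in F m -> y \in fil_pred n -> x * y \in fil_pred (m + n).
Proof.
case: n => [|n]; last by rewrite addnS; apply: filM.
by rewrite mem_fil_pred0 => _ /eqP->; rewrite mulr0 rpred0.
Qed.

Lemma gr_repr (f : gr) n : repr (f n) \in F n.
Proof.
have [_ /(_ n) [x Fx fE]] := grP f.
rewrite -(subrK x (repr (f n))) rpredD // fil_predW //.
by rewrite -quotm_eq reprK fE.
Qed.

Lemma gr0P : gr_axiom (fun n => 0).
Proof. by split; [exists 0%N | exists 0; rewrite ?rpred0 ?raddf0]. Qed.

Lemma grDP (f g : gr) : gr_axiom (fun n => f n + g n).
Proof.
have [[N fN] _] := grP f; have [[M gM] _] := grP g; split.
  exists (maxn N M) => n; rewrite geq_max => /andP[/fN-> /gM->].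
  by rewrite addr0.
move=> n; exists (repr (f n) + repr (g n)); first by rewrite rpredD ?gr_repr.
by rewrite raddfD /= !reprK.
Qed.

Lemma grZP a (f : gr) : gr_axiom (fun n => a *: f n).
Proof.
have [[N fN] _] := grP f; split.
  by exists N => n /fN->; rewrite scaler0.
move=> n; exists (a *: repr (f n)); first by rewrite rpredZ ?gr_repr.
by rewrite linearZ /= reprK.
Qed.

Lemma gr1P : gr_axiom (fun n => \pi[n] (if n == 0%N then 1 else 0)).
Proof.
split; first by exists 1%N => -[|n] // _; rewrite raddf0.
move=> n; exists (if n == 0%N then 1 else 0) => //.
by case: n => [|n]; rewrite ?fil1 ?rpred0.
Qed.

Lemma fil_conv (a b : nat -> A) : (forall n, a n \in F n) ->
    (forall n, b n \in F n) ->
  forall n, \sum_(i < n.+1) a i * b (n - i)%N \in F n.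
Proof.
move=> aF bF n; apply: rpred_sum => i _.
by rewrite -[X in _ \in F X](subnKC (leq_ord i)) filM.
Qed.

Lemma grMP (f g : gr) : gr_axiom (fun n =>
  \pi[n] (\sum_(i < n.+1) repr (f i) * repr (g (n - i)%N))).
Proof.
have [[N fN] _] := grP f; have [[M gM] _] := grP g; split; last first.
  move=> n; exists (\sum_(i < n.+1) repr (f i) * repr (g (n - i)%N)) => //.
  by apply: (fil_conv (gr_repr f) (gr_repr g)).
exists (N + M)%N => n leNMn; apply/eqP; rewrite quotm_eq0.
apply: rpred_sum => i _; rewrite -[X in _ \in fil_pred X](subnKC (leq_ord i)).
have [leNi|ltiN] := leqP N i.
  by apply: fil_predMl (gr_repr _ _); rewrite -quotm_eq0 reprK fN.
apply: fil_predMr (gr_repr _ _) _; rewrite -quotm_eq0 reprK gM //.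
rewrite leq_subRL ?leq_ord //; apply: leq_trans leNMn.
by rewrite leq_add2r ltnW.
Qed.

Definition gr0 := Gr gr0P.
Definition grD f g := Gr (grDP f g).
Definition grZ a f := Gr (grZP a f).
Definition grN f := grZ (-1) f.
Definition gr1 := Gr gr1P.
Definition grM f g := Gr (grMP f g).

Lemma grDA : associative grD.
Proof. by move=> f g h; apply: gr_eq => n; apply: addrA. Qed.

Lemma grDC : commutative grD.
Proof. by move=> f g; apply: gr_eq => n; apply: addrC. Qed.

Lemma gr0D : left_id gr0 grD.
Proof. by move=> f; apply: gr_eq => n; apply: add0r. Qed.

Lemma grND : left_inverse gr0 grN grD.
Proof. by move=> f; apply: gr_eq => n; rewrite /= scaleN1r addNr. Qed.

HB.instance Definition _ := GRing.isZmodule.Build gr grDA grDC gr0D grND.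

Lemma grZA a b f : grZ a (grZ b f) = grZ (a * b) f.
Proof. by apply: gr_eq => n; apply: scalerA. Qed.

Lemma gr1Z : left_id 1 grZ.
Proof. by move=> f; apply: gr_eq => n; apply: scale1r. Qed.

Lemma grZDr : right_distributive grZ +%R.
Proof. by move=> a f g; apply: gr_eq => n; apply: scalerDr. Qed.

Lemma grZDl f : {morph grZ^~ f : a b / a + b}.
Proof. by move=> a b; apply: gr_eq => n; apply: scalerDl. Qed.

HB.instance Definition _ :=
  GRing.Zmodule_isLmodule.Build k gr grZA gr1Z grZDr grZDl.

Lemma grME (f g : gr) (a b : nat -> A) :
    (forall n, a n \in F n) -> (forall n, f n = \pi[n] (a n)) ->
    (forall n, b n \in F n) -> (forall n, g n = \pi[n] (b n)) ->
  forall n, grM f g n = \pi[n] (\sum_(i < n.+1) a i * b (n - i)%N).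
Proof.
move=> aF fE bF gE n; apply/eqP; rewrite quotm_eq -sumrB rpred_sum // => i _.
rewrite -[X in _ \in fil_pred X](subnKC (leq_ord i)).
set j := (n - i)%N; set x := repr _; set y := repr _.
have -> : x * y - a i * b j = (x - a i) * y + a i * (y - b j).
  by rewrite mulrBl mulrBr addrA subrK.
apply: rpredD.
  by apply: fil_predMl (gr_repr _ _); rewrite -quotm_eq reprK fE.
by apply: fil_predMr (aF i) _; rewrite -quotm_eq reprK gE.
Qed.

Lemma grMA : associative grM.
Proof.
move=> f g h; apply: gr_eq => n.
pose a i := repr (f i); pose b i := repr (g i); pose c i := repr (h i).
have aF := gr_repr f; have bF := gr_repr g; have cF := gr_repr h.
rewrite (@grME _ _ a (fun m => \sum_(i < m.+1) b i * c (m - i)%N)) //;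
  [|by move=> i; rewrite reprK|exact: fil_conv].
rewrite (@grME _ _ (fun m => \sum_(i < m.+1) a i * b (m - i)%N) c) //;
  [|exact: fil_conv|by move=> i; rewrite reprK].
congr (\pi[n] _).
pose p (u : nat -> A) := \poly_(i < n.+1) u i.
have pE u i : (i <= n)%N -> u i = (p u)`_i by move=> le; rewrite coef_poly ltnS le.
transitivity ((p a * (p b * p c))`_n).
  rewrite coefM; apply: eq_bigr => i _; rewrite -pE ?leq_ord //; congr (_ * _).
  rewrite coefM; apply: eq_bigr => j _.
  have jn : (j <= n)%N by rewrite (leq_trans (leq_ord j)) ?leq_subr.
  by rewrite -!pE // (leq_trans (leq_subr _ _)) ?leq_subr.
rewrite mulrA coefM; apply: eq_bigr => i _.
rewrite -pE ?leq_subr //; congr (_ * _).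
rewrite coefM; apply: eq_bigr => j _.
have jn : (j <= n)%N by rewrite (leq_trans (leq_ord j)) ?leq_ord.
by rewrite -!pE // (leq_trans (leq_subr _ _)) ?leq_ord.
Qed.

Lemma gr1M : left_id gr1 grM.
Proof.
move=> f; apply: gr_eq => n.
rewrite (@grME _ _ (fun m => if m == 0%N then 1 else 0) (fun m => repr (f m))) //;
  [|by case=> [|m]; rewrite ?fil1 ?rpred0|exact: gr_repr|by move=> i; rewrite reprK].
rewrite big_ord_recl /= mul1r subn0 big1 ?addr0 ?reprK // => i _.
by rewrite mul0r.
Qed.

Lemma grM1 : right_id gr1 grM.
Proof.
move=> f; apply: gr_eq => n.
rewrite (@grME _ _ (fun m => repr (f m)) (fun m => if m == 0%N then 1 else 0)) //;
  [|exact: gr_repr|by move=> i; rewrite reprK|by case=> [|m]; rewrite ?fil1 ?rpred0].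
rewrite big_ord_recr /= subnn mulr1 big1 ?add0r ?reprK // => i _.
by rewrite subn_eq0 leqNgt ltn_ord mulr0.
Qed.

Lemma grMDl : left_distributive grM +%R.
Proof.
move=> f g h; apply: gr_eq => n.
rewrite (@grME _ _ (fun m => repr (f m) + repr (g m)) (fun m => repr (h m))).
- rewrite /= -raddfD -big_split /=; congr (\pi[n] _).
  by apply: eq_bigr => i _; rewrite mulrDl.
- by move=> i; rewrite rpredD ?gr_repr.
- by move=> i; rewrite raddfD /= !reprK.
- exact: gr_repr.
- by move=> i; rewrite reprK.
Qed.

Lemma grMDr : right_distributive grM +%R.
Proof.
move=> h f g; apply: gr_eq => n.
rewrite (@grME _ _ (fun m => repr (h m)) (fun m => repr (f m) + repr (g m))).
- rewrite /= -raddfD -big_split /=; congr (\pi[n] _).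
  by apply: eq_bigr => i _; rewrite mulrDr.
- exact: gr_repr.
- by move=> i; rewrite reprK.
- by move=> i; rewrite rpredD ?gr_repr.
- by move=> i; rewrite raddfD /= !reprK.
Qed.

Lemma gr1_neq0 : gr1 != 0.
Proof.
apply/eqP => /(congr1 (fun f : gr => f 0%N)) /= /eqP.
by rewrite quotm_eq0 mem_fil_pred0 oner_eq0.
Qed.

HB.instance Definition _ := GRing.Zmodule_isNzRing.Build gr
  grMA gr1M grM1 grMDl grMDr gr1_neq0.

Lemma grZAl a (f g : gr) : a *: (f * g) = (a *: f) * g.
Proof.
apply: gr_eq => n; rewrite [RHS](@grME (grZ a f) g (fun m => a *: repr (f m)) (fun m => repr (g m))).
- rewrite /= -linearZ /= scaler_sumr; congr (\pi[n] _).
  by apply: eq_bigr => i _; rewrite scalerAl.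
- by move=> i; rewrite rpredZ ?gr_repr.
- by move=> i; rewrite linearZ /= reprK.
- exact: gr_repr.
- by move=> i; rewrite reprK.
Qed.

HB.instance Definition _ := GRing.Lmodule_isLalgebra.Build k gr grZAl.

Lemma grZAr a (f g : gr) : a *: (f * g) = f * (a *: g).
Proof.
apply: gr_eq => n; rewrite [RHS](@grME f (grZ a g) (fun m => repr (f m)) (fun m => a *: repr (g m))).
- rewrite /= -linearZ /= scaler_sumr; congr (\pi[n] _).
  by apply: eq_bigr => i _; rewrite scalerAr.
- exact: gr_repr.
- by move=> i; rewrite reprK.
- by move=> i; rewrite rpredZ ?gr_repr.
- by move=> i; rewrite linearZ /= reprK.
Qed.

HB.instance Definition _ := GRing.Lalgebra_isAlgebra.Build k gr grZAr.

End AssociatedGraded.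

Lemma linear_0 (k : fieldType) (U V : lmodType k) (f : U -> V) :
  linear f -> f 0 = 0.
Proof.
by move=> fL; have := fL (-1) 0 0; rewrite scaler0 addr0 scaleN1r addNr.
Qed.

Section TensorBilinear.
Context {k : fieldType}.

Lemma scale_bilinear (C : lmodType k) (e : C -> k) :
  scalar e -> bilinear_map (fun a b : C => e a *: b).
Proof.
move=> eL; split=> [b a u v|a b u v].
  by rewrite eL scalerDl scalerA.
by rewrite scalerDr !scalerA mulrC.
Qed.

Lemma mul_bilinear (A : algType k) (x y : A) :
  bilinear_map (fun c d => (x * c) \ox (y * d)).
Proof.
split=> [d a u v|c a u v].
  by rewrite mulrDr -scalerAr pureDl.
by rewrite mulrDr -scalerAr pureDr.
Qed.

Lemma tmul_bilinear (A : algType k) (t : tensor A A) :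
  bilinear_map (fun a b => tlift (fun c d => (a * c) \ox (b * d)) t).
Proof.
split=> [b a u v|b a u v]; move: t; apply: tensor_ind.
- by rewrite !(linear_0 (tlift_linear (mul_bilinear _ _))) scaler0 addr0.
- move=> c s t IHs IHt; rewrite !(tlift_linear (mul_bilinear _ _)) IHs IHt.
  by rewrite !scalerDr !scalerA (mulrC a) addrACA.
- by move=> c d; rewrite !tlift_pure ?mulrDl -?scalerAl ?pureDl //;
    apply: mul_bilinear.
- by rewrite !(linear_0 (tlift_linear (mul_bilinear _ _))) scaler0 addr0.
- move=> c s t IHs IHt; rewrite !(tlift_linear (mul_bilinear _ _)) IHs IHt.
  by rewrite !scalerDr !scalerA (mulrC a) addrACA.
- by move=> c d; rewrite !tlift_pure ?mulrDl -?scalerAl ?pureDr //;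
    apply: mul_bilinear.
Qed.

Lemma tmul_linearl (A : algType k) (t : tensor A A) : linear (fun s : tensor A A => tmul s t).
Proof. exact: tlift_linear (tmul_bilinear t). Qed.

Lemma tmul_purel (A : algType k) (a b : A) t :
  tmul (a \ox b) t = tlift (fun c d => (a * c) \ox (b * d)) t.
Proof. by rewrite /tmul tlift_pure //; apply: tmul_bilinear. Qed.

Lemma tmul_linearr (A : algType k) (s : tensor A A) : linear (fun t : tensor A A => tmul s t).
Proof.
move=> a t u; move: s; apply: tensor_ind.
- by rewrite !(linear_0 (tmul_linearl _)) scaler0 addr0.
- move=> c s r IHs IHr; rewrite !tmul_linearl IHs IHr.
  by rewrite !scalerDr !scalerA (mulrC a) addrACA.
by move=> c d; rewrite !tmul_purel (tlift_linear (mul_bilinear _ _)).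
Qed.

Lemma tmul_pure (A : algType k) (a b c d : A) :
  tmul (a \ox b) (c \ox d) = (a * c) \ox (b * d).
Proof. by rewrite tmul_purel tlift_pure //; apply: mul_bilinear. Qed.

End TensorBilinear.

Section CoradicalFiltration.
Context {k : fieldType} (B : bialgType k) (cB : connected_coalg B).

Local Notation line1 := (lspan [set x : B | x = 1]).

Lemma mem_line1 (x : B) : x \in line1 -> exists a, x = a *: 1.
Proof.
move: x; apply: lspan_ind => [|a u v [b ->] [c ->]|x ->].
- by exists 0; rewrite scale0r.
- by exists (a * b + c); rewrite scalerDl scalerA.
- by exists 1; rewrite scale1r.
Qed.

Lemma coradical1 : (1 : B) \in coradical B.
Proof.
apply: mem_lspan; exists line1; last exact: mem_lspan.
split=> [x /mem_line1[a ->]||E _ sE].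
- have -> : comul (a *: (1 : B)) = a *: (1 \ox 1).
    have := comul_linear a (1 : B) 0.
    by rewrite (linear_0 comul_linear) !addr0 comul1.
  by rewrite rpredZ // mem_lspan //; exists 1, 1; split; rewrite ?mem_lspan.
- by exists 1; rewrite ?oner_neq0 ?mem_lspan.
have [[x Ex x0]|E0] := pselect (exists2 x, x \in E & x != 0); last first.
  left=> x Ex; apply/eqP; apply: contrapT => /negP x0; apply: E0.
  by exists x.
right; apply: lspan_sub => y ->.
have [a xE] := mem_line1 (sE x Ex).
have a0 : a != 0 by apply: contraNneq x0 => a0; rewrite xE a0 scale0r.
have -> : 1 = a^-1 *: x by rewrite xE scalerA mulVf ?scale1r.
by rewrite rpredZ.
Qed.

Lemma coradical_scalar (x : B) : x \in coradical B -> exists a, x = a *: 1.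
Proof.
have [e [_ eP]] := cB; move=> /eP[c xE].
have /eP[d oneE] := coradical1; move: xE oneE; rewrite !big_ord1.
set u := e _; set a := c _; set b := d _ => -> oneE.
have b0 : b != 0.
  by apply/eqP=> b0; move/eqP: oneE; rewrite b0 scale0r oner_eq0.
by exists (a / b); rewrite oneE scalerA divfK.
Qed.

Local Notation cfil := (coradical_fil B).

Lemma coradical_filS n : {subset cfil n <= cfil n.+1}.
Proof.
elim: n => [|n IHn] x; last first.
  apply: lspan_sub => t [tl|tr]; apply: mem_lspan; [by left|right].
  move: tr; apply: lspan_sub => s [a [b [_ bn ->]]].
  by apply: mem_lspan; exists a, b; split=> //; apply: IHn.
move/coradical_scalar => [a ->]; rewrite rpredZ //.
change (comul (1 : B) \in lspan
  [set t | t \in tspan (coradical B) predT \/ t \in tspan predT (cfil 0)]).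
rewrite comul1; apply: mem_lspan; left; apply: mem_lspan.
by exists 1, 1; split=> //; apply: coradical1.
Qed.

Lemma coradical_fil1 n : (1 : B) \in cfil n.
Proof. by elim: n => [|n /coradical_filS//]; apply: coradical1. Qed.

Lemma comul_cfil n (x : B) : x \in cfil n.+1 ->
  exists2 h, h \in cfil n.+1 & comul x - 1 \ox h \in tspan predT (cfil n).
Proof.
move=> xn.
have [h hP] : exists h, comul x - 1 \ox h \in tspan predT (cfil n).
  have : comul x \in lspan
    [set t | t \in tspan (coradical B) predT \/ t \in tspan predT (cfil n)].
    exact: xn.
  move: (comul x); apply: lspan_ind => [|a s t [g gP] [h hP]|t [|tr]].
  - by exists 0; rewrite (linear_0 (fun a => pureDr a (1 : B))) subr0 rpred0.
  - exists (a *: g + h); rewrite pureDr opprD addrACA -scalerBr.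
    by rewrite rpredD ?rpredZ.
  - move: t; apply: lspan_ind => [|a s t [g gP] [h hP]|t [d [b [dB _ ->]]]].
    + by exists 0; rewrite (linear_0 (fun a => pureDr a (1 : B))) subr0 rpred0.
    + exists (a *: g + h); rewrite pureDr opprD addrACA -scalerBr.
      by rewrite rpredD ?rpredZ.
    + have [a ->] := coradical_scalar dB; exists (a *: b).
      have := pureDl a (1 : B) 0 b; rewrite addr0.
      have := pureDr a (1 : B) b 0; rewrite addr0 => -> ->.
      rewrite (linear_0 (fun a => pureDr a (1 : B))).
      rewrite (linear_0 (fun a u v => pureDl a (u : B) v b)).
      by rewrite !addr0 subrr rpred0.
  - by exists 0; rewrite (linear_0 (fun a => pureDr a (1 : B))) subr0.
exists h => //.
have eB := scale_bilinear (@counit_scalar k B).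
pose phi := tlift (fun a b : B => counit a *: b).
have phiL : linear phi := tlift_linear eB.
have phin t : t \in tspan predT (cfil n) -> phi t \in cfil n.
  move: t; apply: lspan_ind => [|a s t ? ?|t [a [b [_ bn ->]]]].
  - by rewrite (linear_0 phiL) rpred0.
  - by rewrite phiL rpredD ?rpredZ.
  - by rewrite /phi tlift_pure // rpredZ.
have := phin _ hP.
have -> : comul x - 1 \ox h = -1 *: (1 \ox h) + comul x.
  by rewrite scaleN1r addrC.
rewrite phiL {1 2}/phi tlift_pure // counitl counit1 scale1r scaleN1r.
move=> /coradical_filS hx.
have -> : h = x - (- h + x) by rewrite opprD opprK addrCA subrr addr0.
by rewrite rpredB.
Qed.

Lemma tmul_tspan (D E G : subspace B) (s t : tensor B B) :
    (forall a b, a \in D -> b \in E -> a * b \in G) ->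
    s \in tspan predT D -> t \in tspan predT E ->
  tmul s t \in tspan predT G.
Proof.
move=> DEG sD tE; move: s sD; apply: lspan_ind => [|a u v ? ?|s].
- by rewrite (linear_0 (@tmul_linearl _ B t)) rpred0.
- by rewrite tmul_linearl rpredD ?rpredZ.
move=> [c [d [_ dD ->]]]; move: t tE; apply: lspan_ind => [|a u v ? ?|t].
- by rewrite (linear_0 (@tmul_linearr _ B _)) rpred0.
- by rewrite tmul_linearr rpredD ?rpredZ.
move=> [c' [d' [_ dE ->]]]; rewrite tmul_pure mem_lspan //.
by exists (c * c'), (d * d'); split=> //; apply: DEG.
Qed.

Lemma coradical_filM m n (x y : B) :
  x \in cfil m -> y \in cfil n -> x * y \in cfil (m + n).
Proof.
elim: m n x y => [|m IHm] n x y.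
  by move=> /coradical_scalar[a ->] yn; rewrite -scalerAl mul1r rpredZ.
elim: n x y => [|n IHn] x y xm yn.
  by have [a ->] := coradical_scalar yn; rewrite -scalerAr mulr1 addn0 rpredZ.
have [g gm gP] := comul_cfil xm; have [h hn hP] := comul_cfil yn.
have T1 r (b : B) : b \in cfil r -> 1 \ox b \in tspan predT (cfil r).
  by move=> br; apply: mem_lspan; exists 1, b.
rewrite addSn.
change (comul (x * y) \in lspan [set t | t \in tspan (coradical B) predT \/
                                         t \in tspan predT (cfil (m + n.+1))]).
rewrite comulM -(subrK (1 \ox g) (comul x)) -(subrK (1 \ox h) (comul y)).
move: (comul x - _) (comul y - _) gP hP => s t sP tP.
have tD (u v w : tensor B B) : tmul u (v + w) = tmul u v + tmul u w.
  by have := tmul_linearr u 1 v w; rewrite !scale1r.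
have Dt (u v w : tensor B B) : tmul (u + v) w = tmul u w + tmul v w.
  by have := tmul_linearl w 1 u v; rewrite !scale1r.
rewrite !(tD, Dt); apply: rpredD; apply: rpredD; apply: mem_lspan.
- right; apply: (@tmul_tspan (cfil m) (cfil n)) => // a b am bn.
  by apply: IHm => //; apply: coradical_filS.
- by right; apply: (@tmul_tspan (cfil m.+1) (cfil n)) => [a b am bn||//];
    [|exact: T1]; rewrite addnS -addSn; apply: IHn.
- right; apply: (@tmul_tspan (cfil m) (cfil n.+1)) => //; last exact: T1.
  by move=> a b; apply: IHm.
- left; rewrite tmul_pure mul1r; apply: mem_lspan; exists 1, (g * h).
  by split=> //; apply: coradical1.
Qed.

Definition coradical_filtration : filtration B :=
  Filtration coradical_filS (coradical_fil1 0) coradical_filM.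

End CoradicalFiltration.

Section GelfandKirillov.
Context {k : fieldType} {A : algType k}.
Implicit Types V W : {pred A}.

Definition mulv V W : subspace A :=
  lspan [set x | exists v w, [/\ v \in V, w \in W & x = v * w]].

Fixpoint expv V (n : nat) : subspace A :=
  if n is m.+1 then mulv (expv V m) V else lspan [set 1].

(* k + V + V^2 + ... + V^n *)
Definition growth V (n : nat) : subspace A :=
  lspan [set x | exists2 i, (i <= n)%N & x \in expv V i].

End GelfandKirillov.

Definition GKdim (R : realType) (k : fieldType) (A : algType k) : \bar R :=
  ereal_sup [set limn_esup (fun n => (ln (dimv (growth V n))%:R / ln n%:R)%:E)
            | V in [set V : subspace A | exists d, has_dim V d]].

Definition finitely_generated (k : fieldType) (A : algType k) : Prop :=
  exists s : seq A, forall S : {pred A},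
    subalg_closed S -> {subset s <= S} -> forall x, x \in S.

Definition algebra_iso (k : fieldType) (A B : algType k) : Prop :=
  exists f : {lrmorphism A -> B}, bijective f.

(* Main.v *)
Require Import Defs.
From HB Require Import structures.
From mathcomp Require Import all_boot all_order all_algebra.
From mathcomp Require Import boolp classical_sets reals ereal sequences exp.
From mathcomp Require Import -(notations) freeg mpoly.
From mathcomp Require Import topology normedtype zify.
(* topology has another notion of subspace. *)
Require Import Defs.

(* Let F be the coradical filtration of H and K = gr H. The filtration exhausts H,
   and [F_m, F_n] lies in F_(m+n-1), so that K is commutative. A functional that
   kills F_(d-1) and the products F_i F_(d-i) with 0 < i < d induces, through the
   comultiplication, a derivation of K of degree -d. Given homogeneous elements of
   K that are linearly independent modulo decomposable ones, the derivations dual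
   to them form a triangular system, and in characteristic 0 this forces the
   elements to be algebraically independent. If the families of this kind have
   bounded size, then a maximal one, of size l, generates K, which is thus a
   polynomial ring; lifting its monomials to H gives a basis of H compatible with
   F, so that H and K both have GK dimension l. If the size is unbounded, then H
   and K contain independent ordered monomials in arbitrarily many elements, so both
   dimensions are infinite; and K is not finitely generated, because the derivations
   at the augmentation separate more elements than there are generators. *)

Set Implicit Arguments.
Unset Strict Implicit.
Unset Printing Implicit Defensive.

Import Order.TTheory GRing.Theory Num.Theory.
Local Open Scope quotient_scope.
Local Open Scope ring_scope.

(** * Linear algebra *)

(** Tensors live in a quotient of a free module and no bases are chosen, so membership in a subspace
    of B (x) B is tested by contracting one factor with functionals ([tspan_contl]). This turns the
    coradical filtration into a statement about operators: x lies in F_n iff every [coactl f] with f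
    1 = 0 sends it into F_(n-1). The operators [coactr phi] commute with all [coactl f], which is
    why those with [phi] vanishing on F_(d-1) lower the degree by d and descend to K. The system of
    derivations is triangular and not diagonal because the derivation dual to x_i is controlled only
    on symbols of degree at most that of x_i; on higher ones its value is merely homogeneous of
    positive degree. The cure is to differentiate along a variable of greatest degree among those
    that occur in a relation. *)

Section Dimension.
Context {k : fieldType} {V : lmodType k}.
Implicit Types (W U : subspace V).

Definition independent m (b : 'I_m -> V) : Prop :=
  forall c : 'I_m -> k, \sum_i c i *: b i = 0 -> forall i, c i = 0.

(** The [e i] need not lie in [W]: this is only an upper bound on the dimension, and it passes to
    subsets. *)
Definition spanned (W : {pred V}) (r : nat) : Prop :=
  exists e : 'I_r -> V, forall v, v \in W ->
    exists c : 'I_r -> k, v = \sum_i c i *: e i.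

(** If r < m, the coefficient matrix has a nonzero row vector in its left kernel, which is a
    relation between the [b i]. *)
Lemma steinitz m r (W : {pred V}) (b : 'I_m -> V) :
  spanned W r -> independent b -> (forall i, b i \in W) -> (m <= r)%N.
Proof.
move=> [e eP] bI bW; have /choice[C CE] i := eP _ (bW i).
pose M := \matrix_(i < m, j < r) C i j.
rewrite leqNgt; apply/negP => ltrm.
have /rowV0Pn[v /sub_kermxP vM v0] : kermx M != 0.
  by rewrite -mxrank_eq0 mxrank_ker subn_eq0 -ltnNge
             (leq_ltn_trans (rank_leq_col M)).
case/eqP: v0; apply/rowP => i; rewrite !mxE.
apply: (bI (fun i => v 0 i)).
under eq_bigr => j _ do rewrite CE scaler_sumr.
rewrite exchange_big big1 // => j _ /=.
under eq_bigr => l _ do rewrite scalerA.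
rewrite -scaler_suml; have /rowP/(_ j) := vM; rewrite !mxE => vMj.
rewrite [X in X *: _](_ : _ = 0) ?scale0r // -[RHS]vMj.
by apply: eq_bigr => l _; rewrite mxE.
Qed.

Lemma independent_cons m (b : 'I_m -> V) v :
    independent b -> ~ (exists c : 'I_m -> k, v = \sum_i c i *: b i) ->
  independent (fun i : 'I_m.+1 => oapp b v (unlift ord0 i)).
Proof.
move=> bI vN c; rewrite big_ord_recl unlift_none /= => c0.
have c00 : c ord0 = 0.
  apply: contra_notP vN => /eqP c00.
  exists (fun i => - (c ord0)^-1 * c (fintype.lift ord0 i)).
  under eq_bigr => i _ do rewrite -scalerA.
  rewrite -scaler_sumr; under eq_bigr => i _ do
    rewrite -[b i]/(oapp b v (Some i)) -(liftK ord0 i).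
  move/eqP: c0; rewrite addrC addr_eq0 => /eqP ->.
  by rewrite scalerN scaleNr opprK scalerA mulVf ?scale1r.
move: c0; rewrite c00 scale0r add0r => c0 i.
case: (unliftP ord0 i) => [j ->|->] //.
apply: (bI (c \o fintype.lift ord0)); rewrite -[RHS]c0.
by apply: eq_bigr => l _; rewrite liftK.
Qed.

Lemma max_independent (W : {pred V}) r : spanned W r ->
  exists2 d, (d <= r)%N & exists2 e : 'I_d -> V, independent e /\ (forall i, e i \in W)
    & forall v, v \in W -> exists c : 'I_d -> k, v = \sum_i c i *: e i.
Proof.
move=> sW; pose P m : bool := `[< exists2 b : 'I_m -> V, independent b & forall i, b i \in W >].
have P0 : exists m, P m.
  exists 0%N; apply/asboolP; exists (fun=> 0) => [c _ []|[]] //.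
have Pr m : P m -> (m <= r)%N by move=> /asboolP[b bI bW]; apply: steinitz bI bW.
have [d /asboolP[e eI eW] dmax] := ex_maxnP P0 Pr.
exists d; first by apply/Pr/asboolP; exists e.
exists e => // v vW; apply: contrapT => vN.
suff /dmax : P d.+1 by rewrite ltnn.
apply/asboolP; exists (fun i => oapp e v (unlift ord0 i)) => [|i].
  exact: independent_cons vN.
by case: (unlift ord0 i).
Qed.

Lemma spanned_has_dim W r : spanned W r -> exists2 d, (d <= r)%N & has_dim W d.
Proof.
move=> /max_independent[d dr [e [eI eW] eS]]; exists d => //; exists e; split=> // v.
split=> [/eS//|[c ->]]; by rewrite rpred_sum // => i _; rewrite rpredZ.
Qed.

Lemma has_dim_mem W d (e : 'I_d -> V) i :
  (forall v, v \in W <-> exists c : 'I_d -> k, v = \sum_i c i *: e i) -> e i \in W.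
Proof.
move=> eW; apply/eW; exists (fun j => (j == i)%:R).
by rewrite (bigD1 i) //= eqxx scale1r big1 ?addr0 // => j /negPf->; rewrite scale0r.
Qed.

Lemma has_dim_spanned W d : has_dim W d -> spanned W d.
Proof. by move=> [e [_ eW]]; exists e => v /eW. Qed.

Lemma has_dim_le W m d (b : 'I_m -> V) :
  has_dim W d -> independent b -> (forall i, b i \in W) -> (m <= d)%N.
Proof. by move=> /has_dim_spanned; apply: steinitz. Qed.

Lemma has_dim_ge W r d : spanned W r -> has_dim W d -> (d <= r)%N.
Proof.
by move=> sW [e [eI eW]]; apply: (steinitz sW eI) => i; apply: has_dim_mem eW.
Qed.

Lemma dimvE W d : has_dim W d -> dimv W = d.
Proof.
move=> Wd; apply: xget_unique => // d' Wd'; apply/eqP; rewrite eqn_leq.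
by rewrite (has_dim_ge (has_dim_spanned Wd) Wd') (has_dim_ge (has_dim_spanned Wd') Wd).
Qed.

Lemma has_dim_sub U W d : {subset U <= W} -> has_dim W d ->
  exists2 d', has_dim U d' & ({subset W <= U} \/ (d' < d)%N).
Proof.
move=> UW Wd; have [e0 [_ e0W]] := Wd.
have /spanned_has_dim[d' d'd Ud'] : spanned U d by exists e0 => v /UW/e0W.
exists d' => //; move: d'd; rewrite leq_eqVlt => /predU1P[dE|]; [left|by right].
have [e [eI eU]] := Ud'; move=> w wW; apply/eU; apply: contrapT => wN.
suff : (d'.+1 <= d)%N by rewrite dE ltnn.
apply: (has_dim_le Wd (independent_cons eI wN)) => i.
by case: (unlift ord0 i) => [j|] //=; apply/UW/(has_dim_mem _ eU).
Qed.

End Dimension.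

(** * Separation by linear functionals *)

Section Functional.
Context {k : fieldType} {V : lmodType k}.
Implicit Types W : subspace V.

(** Zorn: [L] is maximal among the subspaces that contain [W] and avoid [v], and maximality makes it
    a hyperplane complementary to [v]. *)
Lemma subspace_ext W v : v \notin W -> exists L : subspace V,
  [/\ {subset W <= L}, v \notin L & forall x, exists a, x - a *: v \in L].
Proof.
move=> vW.
pose T := {L : subspace V | {subset W <= L} /\ v \notin L}.
pose R (L M : T) : bool := `[< {subset sval L <= sval M} >].
have TW : {subset W <= W} /\ v \notin W by split.
have [|||L Lmax] := @ZL_preorder T (exist _ W TW) R.
- by move=> L; apply/asboolP.
- by move=> M L N /asboolP LM /asboolP MN; apply/asboolP => x /LM/MN.
- move=> A Atot; have [[L0 AL0]|A0] := pselect (exists L, A L); last first.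
    by exists (exist _ W TW) => L AL; case: A0; exists L.
  pose Up : {pred V} := fun x => `[< exists2 L : T, A L & x \in sval L >].
  have cU : submod_closed Up.
    split=> [|a x y /asboolP[L AL xL] /asboolP[M AM yM]].
      by apply/asboolP; exists L0; rewrite ?rpred0.
    apply/asboolP; have [/asboolP s|/asboolP s] := Atot _ _ AL AM.
      by exists M => //; apply: rpredD yM; apply/rpredZ/s.
    by exists L => //; apply: rpredD (s _ yM); apply: rpredZ.
  have UT : {subset W <= Subspace cU} /\ v \notin Subspace cU.
    split=> [x xW|]; first by apply/asboolP; exists L0 => //; apply: (svalP L0).1.
    by apply/asboolP => -[L _]; apply/negP; apply: (svalP L).2.
  exists (exist (fun L : subspace V => {subset W <= L} /\ v \notin L) _ UT) => L AL.
  by apply/asboolP => x xL; apply/asboolP; exists L.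
have [WL vL] := svalP L; exists (sval L); split=> // x.
have [xL|xL] := boolP (x \in sval L); first by exists 0; rewrite scale0r subr0.
(* [Xp] is L + k x; as [x] is not in [L], maximality forces [v] into it. *)
pose Xp : {pred V} := fun y => `[< exists a, y - a *: x \in sval L >].
have cX : submod_closed Xp.
  split=> [|a y z /asboolP[b yb] /asboolP[c zc]].
    by apply/asboolP; exists 0; rewrite scale0r subr0 rpred0.
  apply/asboolP; exists (a * b + c).
  by rewrite scalerDl opprD addrACA -scalerA -scalerBr rpredD ?rpredZ.
have LX : {subset sval L <= Subspace cX}.
  by move=> y yL; apply/asboolP; exists 0; rewrite scale0r subr0.
have xX : x \in Subspace cX by apply/asboolP; exists 1; rewrite scale1r subrr rpred0.
have /asboolP[a va] : v \in Subspace cX.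
  apply: contraNT xL => vX.
  have TX : {subset W <= Subspace cX} /\ v \notin Subspace cX.
    by split=> // y /WL/LX.
  have /Lmax/asboolP-> // : R L (exist (fun L : subspace V => {subset W <= L} /\ v \notin L) _ TX).
  exact/asboolP.
have a0 : a != 0.
  by apply: contraNneq vL => a0; move: va; rewrite a0 scale0r subr0.
exists a^-1; rewrite -opprB rpredN.
have -> : a^-1 *: v - x = a^-1 *: (v - a *: x).
  by rewrite scalerBr scalerA mulVf // scale1r.
by rewrite rpredZ.
Qed.

(** [phi x] is the coefficient of [v] when [x] is decomposed along the hyperplane [L]; it is unique
    because [v] is not in [L]. *)
Lemma functional_sep W v : v \notin W ->
  exists2 phi : {scalar V}, (forall w, w \in W -> phi w = 0) & phi v = 1.
Proof.
move=> /subspace_ext[L [WL vL /choice[phi phiP]]].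
have phiE x a : x - a *: v \in L -> phi x = a.
  move=> xa; apply/eqP; rewrite -subr_eq0; apply: contraNT vL => /negPf pa.
  have : (phi x - a) *: v \in L.
    have -> : (phi x - a) *: v = (x - a *: v) - (x - phi x *: v).
      by rewrite scalerBl [RHS]addrC opprB addrA subrK.
    by rewrite rpredB.
  by move=> /(rpredZ (phi x - a)^-1); rewrite scalerA mulVf ?pa ?scale1r.
have phiL : scalar phi.
  move=> a x y; apply: phiE; rewrite scalerDl opprD addrACA -scalerA -scalerBr.
  by rewrite rpredD ?rpredZ.
exists (HB.pack_for {scalar V} phi (GRing.isLinear.Build k V k *%R phi phiL)).
  by move=> w wW; apply: phiE; rewrite scale0r subr0 WL.
by apply: phiE; rewrite scale1r subrr rpred0.
Qed.

End Functional.

(** * Tensor products *)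

Section TensorTheory.
Context {k : fieldType}.
Implicit Types U V W X : lmodType k.

Lemma tensor_ext U V W (F G : {linear tensor U V -> W}) :
  (forall u v, F (u \ox v) = G (u \ox v)) -> F =1 G.
Proof.
move=> FG; apply: tensor_ind => [|a s t Fs Ft|//]; first by rewrite !raddf0.
by rewrite !linearP Fs Ft.
Qed.

Lemma pure_bilinear U V : bilinear_map (fun (u : U) (v : V) => u \ox v).
Proof. by split=> [v a u u'|u a v v']; rewrite ?pureDl ?pureDr. Qed.

Lemma pure0l U V (v : V) : (0 : U) \ox v = 0.
Proof. exact: (linear_0 ((pure_bilinear U V).1 v)). Qed.

Lemma pure0r U V (u : U) : u \ox (0 : V) = 0.
Proof. exact: (linear_0 ((pure_bilinear U V).2 u)). Qed.

Lemma pureZl U V a (u : U) (v : V) : (a *: u) \ox v = a *: (u \ox v).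
Proof. by rewrite -[a *: u]addr0 pureDl pure0l addr0. Qed.

Lemma pureZr U V a (u : U) (v : V) : u \ox (a *: v) = a *: (u \ox v).
Proof. by rewrite -[a *: v]addr0 pureDr pure0r addr0. Qed.

Lemma pure_addl U V (u u' : U) (v : V) : (u + u') \ox v = u \ox v + u' \ox v.
Proof. by rewrite -[u]scale1r pureDl !scale1r. Qed.

Lemma pure_addr U V (u : U) (v v' : V) : u \ox (v + v') = u \ox v + u \ox v'.
Proof. by rewrite -[v]scale1r pureDr !scale1r. Qed.

Lemma pure_sumlZ U V n (c : 'I_n -> k) (u : 'I_n -> U) (v : V) :
  (\sum_i c i *: u i) \ox v = \sum_i u i \ox (c i *: v).
Proof.
elim/big_rec2: _ => [|i y x _ <-]; first by rewrite pure0l.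
by rewrite pureDl pureZr.
Qed.

Lemma contl_bilinear U V (f : {scalar U}) : bilinear_map (fun u (v : V) => f u *: v).
Proof.
split=> [v a u u'|u a v v']; first by rewrite linearP scalerDl scalerA.
by rewrite scalerDr !scalerA mulrC.
Qed.

Lemma contr_bilinear U V (f : {scalar V}) : bilinear_map (fun (u : U) v => f v *: u).
Proof.
split=> [v a u u'|u a v v']; last by rewrite linearP scalerDl scalerA.
by rewrite scalerDr !scalerA mulrC.
Qed.

(** Contraction of one factor: f (x) id and id (x) f, with k (x) V identified with V and U (x) k
    with U. *)
Definition tconl U V (f : {scalar U}) : tensor U V -> V := tlift (fun u v => f u *: v).
Definition tconr U V (f : {scalar V}) : tensor U V -> U := tlift (fun u v => f v *: u).

HB.instance Definition _ U V f := GRing.isLinear.Build k (tensor U V) V *:%R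
  (tconl f) (tlift_linear (contl_bilinear V f)).
HB.instance Definition _ U V f := GRing.isLinear.Build k (tensor U V) U *:%R
  (tconr f) (tlift_linear (contr_bilinear U f)).

Lemma tconl_pure U V (f : {scalar U}) u (v : V) : tconl f (u \ox v) = f u *: v.
Proof. exact: tlift_pure (contl_bilinear _ _) _ _. Qed.

Lemma tconr_pure U V (f : {scalar V}) (u : U) v : tconr f (u \ox v) = f v *: u.
Proof. exact: tlift_pure (contr_bilinear _ _) _ _. Qed.

Lemma swap_bilinear U V : bilinear_map (fun (u : U) (v : V) => v \ox u).
Proof. by split=> [v a u u'|u a v v']; rewrite ?pureDl ?pureDr. Qed.

Definition tswap U V : tensor U V -> tensor V U := tlift (fun u v => v \ox u).

HB.instance Definition _ U V := GRing.isLinear.Build k (tensor U V) (tensor V U) *:%R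
  (@tswap U V) (tlift_linear (@swap_bilinear U V)).

Lemma tswap_pure U V (u : U) (v : V) : tswap (u \ox v) = v \ox u.
Proof. exact: tlift_pure (@swap_bilinear U V) _ _. Qed.

Lemma tswapK U V : cancel (@tswap U V) (@tswap V U).
Proof.
by apply: (@tensor_ext _ _ _ (@tswap V U \o @tswap U V) idfun) => u v /=; rewrite !tswap_pure.
Qed.

Lemma tconl_tswap U V (f : {scalar V}) (t : tensor U V) : tconl f (tswap t) = tconr f t.
Proof.
move: t; apply: (@tensor_ext _ _ _ (tconl f \o @tswap U V)) => u v /=.
by rewrite tswap_pure tconl_pure tconr_pure.
Qed.

Lemma tmap_bilinear U V U' V' (f : {linear U -> U'}) (g : {linear V -> V'}) :
  bilinear_map (fun u v => f u \ox g v).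
Proof. by split=> [v a u u'|u a v v']; rewrite linearP ?pureDl ?pureDr. Qed.

HB.instance Definition _ U V U' V' (f : {linear U -> U'}) (g : {linear V -> V'}) :=
  GRing.isLinear.Build k (tensor U V) (tensor U' V') *:%R
  (tmap f g) (tlift_linear (tmap_bilinear f g)).

Lemma tmap_pure U V U' V' (f : {linear U -> U'}) (g : {linear V -> V'}) u v :
  tmap f g (u \ox v) = f u \ox g v.
Proof. exact: tlift_pure (tmap_bilinear f g) _ _. Qed.

Lemma tassocr_bilinear U V W (w : W) :
  bilinear_map (fun (u : U) (v : V) => u \ox (v \ox w)).
Proof. by split=> [v a u u'|u a v v']; rewrite ?pureDl ?pureDr. Qed.

Lemma tassoc_bilinear U V W : bilinear_map
  (fun t (w : W) => tlift (fun (u : U) (v : V) => u \ox (v \ox w)) t).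
Proof.
pose G (w : W) := tlift (fun (u : U) (v : V) => u \ox (v \ox w)).
have GL (w : W) : linear (G w) := tlift_linear (tassocr_bilinear U V w).
split=> [w|t a w w']; first exact: GL.
change (G (a *: w + w') t = a *: G w t + G w' t).
move: t; apply: tensor_ind => [|b s t Hs Ht|u v].
- by rewrite !(linear_0 (GL _)) scaler0 addr0.
- by rewrite !GL Hs Ht !scalerDr !scalerA (mulrC a) addrACA.
- by rewrite /G !(tlift_pure (tassocr_bilinear U V _)) !pureDr.
Qed.

HB.instance Definition _ U V W := GRing.isLinear.Build k
  (tensor (tensor U V) W) (tensor U (tensor V W)) *:%R
  (@tassoc k U V W) (tlift_linear (@tassoc_bilinear U V W)).

Lemma tassoc_pure U V W (u : U) (v : V) (w : W) :
  tassoc ((u \ox v) \ox w) = u \ox (v \ox w).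
Proof.
rewrite /tassoc (tlift_pure (@tassoc_bilinear U V W)).
by rewrite (tlift_pure (tassocr_bilinear _ _ _)).
Qed.

Lemma mem_tspan U V (D : {pred U}) (E : {pred V}) d e :
  d \in D -> e \in E -> d \ox e \in tspan D E.
Proof. by move=> dD eE; apply: mem_lspan; exists d, e. Qed.

Lemma lspan_img U V (F : U -> V) (A : set U) (W : subspace V) : linear F ->
  (forall x, A x -> F x \in W) -> forall x, x \in lspan A -> F x \in W.
Proof.
move=> FL FA; apply: lspan_ind => [|a x y Fx Fy|//]; first by rewrite linear_0 ?rpred0.
by rewrite FL rpredD ?rpredZ.
Qed.

Lemma tspan_img U V W (F : tensor U V -> W) (D : {pred U}) (E : {pred V})
    (X : subspace W) : linear F ->
  (forall d e, d \in D -> e \in E -> F (d \ox e) \in X) ->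
  forall t, t \in tspan D E -> F t \in X.
Proof. by move=> FL FX; apply: lspan_img => // _ [d [e [dD eE ->]]]; apply: FX. Qed.

Lemma tspanS U V (D D' : {pred U}) (E E' : {pred V}) :
  {subset D <= D'} -> {subset E <= E'} -> {subset tspan D E <= tspan D' E'}.
Proof.
move=> DD EE; apply: lspan_sub => _ [d [e [dD eE ->]]].
by rewrite mem_tspan ?DD ?EE.
Qed.

Lemma tswap_tspan U V (D : {pred U}) (E : {pred V}) t :
  t \in tspan D E -> tswap t \in tspan E D.
Proof.
move: t; apply: tspan_img => [|d e dD eE]; first exact: linearP.
by rewrite tswap_pure mem_tspan.
Qed.

(** Scalars are absorbed by the left factors, hence [D] is a subspace while [E] is any predicate. *)
Lemma tspan_sum U V (D : subspace U) (E : {pred V}) t : t \in tspan D E ->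
  exists n (u : 'I_n -> U) (v : 'I_n -> V),
    [/\ forall i, u i \in D, forall i, v i \in E & t = \sum_i u i \ox v i].
Proof.
move: t; apply: lspan_ind => [|a s t [n [u [v [uD vE ->]]]] [m [u' [v' [uD' vE' ->]]]]|].
- by exists 0%N, (fun=> 0), (fun=> 0); split=> [[]|[]|] //; rewrite big_ord0.
- exists (n + m)%N, (fun i => match split i with inl j => a *: u j | inr j => u' j end),
    (fun i => match split i with inl j => v j | inr j => v' j end).
  split=> [i|i|]; try by case: (split i) => j; rewrite ?rpredZ.
  rewrite big_split_ord scaler_sumr; congr (_ + _); apply: eq_bigr => i _.
    by rewrite (unsplitK (inl i)) pureZl.
  by rewrite (unsplitK (inr i)).
- move=> _ [d [e [dD eE ->]]]; exists 1%N, (fun=> d), (fun=> e).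
  by split=> //; rewrite big_ord1.
Qed.

Definition lspan2 V (A B : subspace V) : subspace V :=
  lspan [set x | x \in A \/ x \in B].

Lemma lspan2P V (A B : subspace V) x :
  reflect (exists2 a, a \in A & x - a \in B) (x \in lspan2 A B).
Proof.
apply: (iffP idP) => [|[a aA xB]]; last first.
  by rewrite -[x](subrK a) rpredD //; apply: mem_lspan; [right|left].
move: x; apply: lspan_ind => [|c x y [a aA xa] [b bA yb]|x [xA|xB]].
- by exists 0; rewrite ?subr0 rpred0.
- exists (c *: a + b); first by rewrite rpredD ?rpredZ.
  by rewrite opprD addrACA -scalerBr rpredD ?rpredZ.
- by exists x; rewrite ?subrr ?rpred0.
- by exists 0; rewrite ?subr0 ?rpred0.
Qed.

Lemma mem_lspan2l V (A B : subspace V) : {subset A <= lspan2 A B}.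
Proof. by move=> x xA; apply: mem_lspan; left. Qed.

Lemma mem_lspan2r V (A B : subspace V) : {subset B <= lspan2 A B}.
Proof. by move=> x xA; apply: mem_lspan; right. Qed.

Definition famspan V n (e : 'I_n -> V) : subspace V := lspan [set x | exists i, x = e i].

Lemma famspanP V n (e : 'I_n -> V) x :
  x \in famspan e <-> exists c : 'I_n -> k, x = \sum_i c i *: e i.
Proof.
split=> [|[c ->]]; last first.
  by rewrite rpred_sum // => i _; rewrite rpredZ // mem_lspan //; exists i.
move: x; apply: lspan_ind => [|a _ _ [c ->] [d ->]|_ [i ->]].
- by exists (fun=> 0); rewrite big1 // => i _; rewrite scale0r.
- exists (fun i => a * c i + d i); rewrite scaler_sumr -big_split.
  by apply: eq_bigr => i _; rewrite scalerDl scalerA.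
- exists (fun j => (j == i)%:R); rewrite (bigD1 i) //= eqxx scale1r.
  by rewrite big1 ?addr0 // => j /negPf->; rewrite scale0r.
Qed.

(* Functionals on the left factor detect A0 (x) V + A (x) B inside A (x) V:
   shorten an expression of t until its left factors are independent modulo A0,
   and then read off the right factors by dual functionals. *)
Lemma tspan_contl U V (A0 A : subspace U) (B : subspace V) t :
    t \in tspan A predT ->
    (forall f : {scalar U}, (forall a, a \in A0 -> f a = 0) -> tconl f t \in B) ->
  t \in lspan2 (tspan A0 predT) (tspan A B).
Proof.
move=> /tspan_sum[n [u [v [uA _ ->]]]].
elim: n => [|n IHn] in u v uA *; first by rewrite big_ord0 rpred0.
rewrite big_ord_recl; set u0 := u ord0; set v0 := v ord0.
set u' := fun i => u (fintype.lift ord0 i); set v' := fun i => v (fintype.lift ord0 i).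
move=> tB.
have [/lspan2P[a aA0 /famspanP[c uE]]|uN] := boolP (u0 \in lspan2 A0 (famspan u')).
  have tE : u0 \ox v0 + \sum_i u' i \ox v' i =
            a \ox v0 + \sum_i u' i \ox (c i *: v0 + v' i).
    rewrite -{1}[u0](subrK a) [_ + a]addrC pure_addl uE pure_sumlZ -addrA -big_split /=.
    by congr (_ + _); apply: eq_bigr => i _; rewrite -pure_addr.
  rewrite tE rpredD //; first by apply/mem_lspan2l/mem_tspan.
  apply: IHn => [i|f fA0]; first exact: uA.
  have := tB f fA0; rewrite tE raddfD /= tconl_pure fA0 // scale0r add0r.
  exact.
have [f f0 f1] := functional_sep uN.
have fA0 a : a \in A0 -> f a = 0 by move=> aA0; apply/f0/mem_lspan2l.
have fu' i : f (u' i) = 0.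
  by apply/f0/mem_lspan2r; apply: mem_lspan; exists i.
have v0B : v0 \in B.
  have := tB f fA0; rewrite raddfD raddf_sum /= tconl_pure f1 scale1r.
  by rewrite big1 ?addr0 // => i _; rewrite tconl_pure fu' scale0r.
rewrite rpredD //; first by apply/mem_lspan2r/mem_tspan; rewrite ?uA.
apply: IHn => [i|g gA0]; first exact: uA.
have := tB g gA0; rewrite raddfD /= tconl_pure => gB.
by have := rpredB gB (rpredZ (g u0) v0B); rewrite addrAC subrr add0r.
Qed.

Lemma tspan_contr U V (B0 B : subspace V) (A : subspace U) t :
    t \in tspan predT B ->
    (forall f : {scalar V}, (forall b, b \in B0 -> f b = 0) -> tconr f t \in A) ->
  t \in lspan2 (tspan predT B0) (tspan A B).
Proof.
move=> tB tA; rewrite -[t]tswapK.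
have : tswap t \in lspan2 (tspan B0 predT) (tspan B A).
  apply: tspan_contl => [|f fB0]; last by rewrite tconl_tswap tA.
  exact: tswap_tspan.
apply: lspan_img => [|s [sB|sB]]; first exact: linearP.
  by apply/mem_lspan2l/tswap_tspan.
by apply/mem_lspan2r/tswap_tspan.
Qed.

End TensorTheory.

(** * Functionals acting on a coalgebra *)

HB.instance Definition _ (k : fieldType) (C : coalgType k) :=
  GRing.isLinear.Build k C (tensor C C) *:%R comul comul_linear.
HB.instance Definition _ (k : fieldType) (C : coalgType k) :=
  GRing.isLinear.Build k C k *%R counit counit_scalar.

Section Coactions.
Context {k : fieldType} {C : coalgType k}.
Implicit Types f g : {scalar C}.

(** The two actions of the dual algebra on [C]. *)
Definition coactl f : C -> C := tconl f \o comul.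
Definition coactr f : C -> C := tconr f \o comul.

HB.instance Definition _ f := GRing.Linear.copy (coactl f) (tconl f \o comul).
HB.instance Definition _ f := GRing.Linear.copy (coactr f) (tconr f \o comul).

Lemma coactl_counit (x : C) : coactl counit x = x.
Proof. exact: counitl. Qed.

Lemma coactr_counit (x : C) : coactr counit x = x.
Proof. exact: counitr. Qed.

(** Both sides are the convolution product of f and g at x. *)
Lemma fun_coact f g x : f (coactr g x) = g (coactl f x).
Proof.
pose F : {linear tensor C C -> k^o} := f \o tconr g.
pose G : {linear tensor C C -> k^o} := g \o tconl f.
apply: (tensor_ext (F := F) (G := G)) => u v /=.
by rewrite tconl_pure tconr_pure !linearZ; apply: mulrC.
Qed.

Lemma counit_coactl f x : counit (coactl f x) = f x.
Proof. by rewrite -fun_coact coactr_counit. Qed.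

Lemma counit_coactr f x : counit (coactr f x) = f x.
Proof. by rewrite fun_coact coactl_counit. Qed.

Lemma tconl_tassoc f g (s : tensor C C) (x : C) :
  tconl g (tconl f (tassoc (s \ox x))) = g (tconl f s) *: x.
Proof.
move: s; apply: tensor_ind => [|a s t Hs Ht|u v].
- by rewrite pure0l !raddf0 scale0r.
- by rewrite pureDl !linearP /= Hs Ht scalerDl scalerA.
by rewrite tassoc_pure !tconl_pure !linearZ /= tconl_pure scalerA.
Qed.

(** Coassociativity in operator form: [g \o coactl f] is the convolution product of f and g. *)
Lemma coactlA f g x : coactl g (coactl f x) = coactl (g \o coactl f) x.
Proof.
rewrite /coactl /=.
transitivity (tconl g (tconl f (tmap id comul (comul x)))).
  apply: (@tensor_ext _ _ _ _ (tconl g \o comul \o tconl f)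
            (tconl g \o tconl f \o tmap idfun comul)) => u v /=.
  by rewrite tmap_pure !tconl_pure !linearZ.
rewrite -comulA.
apply: (@tensor_ext _ _ _ _ (tconl g \o tconl f \o @tassoc k C C C \o tmap comul idfun)
         (tconl (g \o coactl f))) => a b /=.
by rewrite tmap_pure tconl_pure tconl_tassoc.
Qed.

Lemma functional_inj (V : lmodType k) (x y : V) :
  (forall f : {scalar V}, f x = f y) -> x = y.
Proof.
move=> fxy; apply/eqP; rewrite -subr_eq0; apply: contraT => xy0.
have [f _ /eqP] : exists2 f : {scalar V}, (forall w, w \in famspan (fun _ : 'I_0 => 0) -> f w = 0)
    & f (x - y) = 1.
  apply: functional_sep; apply: contraNN xy0 => /famspanP[c ->].
  by rewrite big_ord0.
by rewrite raddfB /= fxy subrr eq_sym oner_eq0.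
Qed.

(** Against any functional h, both sides give the convolution product of f, h and g at x. *)
Lemma coactC f g x : coactl f (coactr g x) = coactr g (coactl f x).
Proof.
apply: functional_inj => h.
by rewrite -[LHS]/((h \o coactl f) (coactr g x)) (fun_coact (h \o coactl f)) -coactlA fun_coact.
Qed.

Lemma coactrA f g x : coactr g (coactr f x) = coactr (g \o coactr f) x.
Proof.
apply: functional_inj => h.
by rewrite fun_coact coactC [RHS]fun_coact.
Qed.

End Coactions.

(* Keeps /= from unfolding W in x \in W. *)
Arguments subspace_pred : simpl never.

(** * Commutators in the tensor square of an algebra *)

Section TensorProductAlgebra.
Context {k : fieldType} {A : algType k}.
Implicit Types s t u : tensor A A.

Lemma tmulDl s t u : tmul (s + t) u = tmul s u + tmul t u.
Proof. by have := tmul_linearl u 1 s t; rewrite !scale1r. Qed.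

Lemma tmulDr s t u : tmul s (t + u) = tmul s t + tmul s u.
Proof. by have := tmul_linearr s 1 t u; rewrite !scale1r. Qed.

Definition tcomm s t : tensor A A := tmul s t - tmul t s.

Lemma tcommDl s t u : tcomm (s + t) u = tcomm s u + tcomm t u.
Proof. by rewrite /tcomm tmulDl tmulDr opprD addrACA. Qed.

Lemma tcommDr s t u : tcomm s (t + u) = tcomm s t + tcomm s u.
Proof. by rewrite /tcomm tmulDl tmulDr opprD addrACA. Qed.

Lemma tcomm_linearr s : linear (tcomm s).
Proof.
move=> a t u; rewrite /tcomm tmul_linearr tmul_linearl opprD addrACA.
by rewrite -scalerBr.
Qed.

HB.instance Definition _ s :=
  GRing.isLinear.Build k (tensor A A) (tensor A A) *:%R (tcomm s) (tcomm_linearr s).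

(** The commutator of 1 (x) g with a (x) b is a (x) (g b - b g). *)
Lemma tcomm1_tspan (g : A) (E : {pred A}) (G : subspace A) t :
    (forall b, b \in E -> g * b - b * g \in G) -> t \in tspan predT E ->
  tcomm (1 \ox g) t \in tspan predT G.
Proof.
move=> gG; apply: tspan_img => [|a b _ bE]; first exact: tcomm_linearr.
rewrite /tcomm !tmul_pure mul1r mulr1 -scaleN1r -pureZr -pure_addr scaleN1r.
by rewrite mem_tspan ?gG.
Qed.

Lemma tcommC s t : tcomm s t = - tcomm t s.
Proof. by rewrite /tcomm opprB. Qed.

End TensorProductAlgebra.

Section FullSubspace.
Context {k : fieldType} (V : lmodType k).

Lemma predT_submod_closed : submod_closed (predT : {pred V}).
Proof. by []. Qed.

Definition fullspace : subspace V := Subspace predT_submod_closed.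

Lemma mem_tspan_full (U : lmodType k) (t : tensor V U) : t \in tspan fullspace predT.
Proof.
move: t; apply: tensor_ind => [|a s t sT tT|u v]; rewrite ?rpred0 //.
  by rewrite rpredD ?rpredZ.
by rewrite mem_tspan.
Qed.

End FullSubspace.

(** * The coradical filtration of a connected bialgebra *)

Section ConnectedFiltration.
Context {k : fieldType} {B : bialgType k} (cB : connected_coalg B).
Local Notation F := (coradical_filtration cB).
Local Notation fp := (fil_pred F).
Implicit Types f phi : {scalar B}.

Lemma coactl1 f : coactl f (1 : B) = f 1 *: 1.
Proof. by rewrite /coactl /= comul1 tconl_pure. Qed.

Lemma coradical_scale (a : k) : a *: (1 : B) \in coradical B.
Proof. by rewrite rpredZ // coradical1. Qed.

(** The comultiplication of [x] is 1 (x) h modulo B (x) F_(n-1), and contraction by [f] kills 1 (x)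
    h. Indices are shifted: [fp n] is F_(n-1). *)
Lemma coactl_fp n x f : x \in fp n.+1 -> f 1 = 0 -> coactl f x \in fp n.
Proof.
case: n => [|n] xn f1.
  have [a ->] := coradical_scalar cB xn.
  by rewrite mem_fil_pred0 linearZ /= coactl1 f1 scale0r scaler0.
have [h _ hP] := comul_cfil cB xn.
rewrite /coactl /= -[comul x](subrK (1 \ox h)) raddfD /= tconl_pure f1 scale0r addr0.
move: hP; apply: tspan_img => [|a b _ bn]; first exact: linearP.
by rewrite tconl_pure rpredZ.
Qed.

(** The converse of [coactl_fp]. For n > 0 it is [tspan_contl] with F_0 = k 1 as the killed
    subspace. For n = 0, a functional [f] separating [x] from F_0 is impossible, since f x is the
    counit of [coactl f x], which is 0. *)
Lemma fp_coactl n x :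
  (forall f, f 1 = 0 -> coactl f x \in fp n) -> x \in fp n.+1.
Proof.
case: n => [|n] xn.
  apply: contraT => /functional_sep[f f0 /eqP]; rewrite -counit_coactl.
  have := xn f (f0 _ (coradical1 B)); rewrite mem_fil_pred0 => /eqP->.
  by rewrite raddf0 eq_sym oner_eq0.
have := tspan_contl (mem_tspan_full (comul x)) _.
move=> /(_ (coradical B) (coradical_fil B n)) xW.
have {}xW : comul x \in lspan2 (tspan (coradical B) predT)
                               (tspan (fullspace B) (coradical_fil B n)).
  apply: xW => f f0; apply: xn; apply: f0; exact: coradical1.
move: xW; apply: lspan_sub => t [tl|tr]; apply: mem_lspan; [by left|right].
by move: t tr; apply: tspanS.
Qed.

Lemma comul_tspan_cfil n x : x \in F n -> comul x \in tspan predT (F n).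
Proof.
case: n => [|n] xn.
  have [a ->] := coradical_scalar cB xn.
  have -> : comul (a *: (1 : B)) = a *: (1 \ox 1) by rewrite linearZ /= comul1.
  by rewrite rpredZ // mem_tspan // coradical1.
have [h hn hP] := comul_cfil cB xn.
rewrite -[comul x](subrK (1 \ox h)) rpredD ?mem_tspan //.
by move: hP; apply: tspanS => // y; apply: coradical_filS.
Qed.

Lemma fpS n : {subset fp n <= fp n.+1}.
Proof. by move=> x; apply: fil_predW. Qed.

Lemma fp_leq m n : (m <= n)%N -> {subset fp m <= fp n}.
Proof.
move=> /subnK <-; elim: (n - m)%N => [//|d IHd] x xm.
by rewrite addSn; apply/fpS/IHd.
Qed.

(** Induction on n through [fp_coactl], since [coactr phi] commutes with every [coactl f]. When n is
    at most d, the right factors of the comultiplication lie in F_(d-1), where [phi] vanishes. *)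
Lemma coactr_fp n d x phi : (forall y, y \in fp d -> phi y = 0) ->
  x \in fp n -> coactr phi x \in fp (n - d).
Proof.
move=> phi0; elim: n x => [|n IHn] x xn.
  by move: xn; rewrite mem_fil_pred0 => /eqP ->; rewrite raddf0 rpred0.
have [ltnd|ledn] := ltnP n d; last first.
  rewrite subSn //; apply: fp_coactl => f f1.
  by rewrite coactC; apply/IHn/coactl_fp.
suff -> : coactr phi x = 0 by rewrite rpred0.
apply/eqP; rewrite -(mem_fil_pred0 F).
change (tconr phi (comul x) \in fp 0).
move: (comul_tspan_cfil xn); apply: tspan_img => [|a b _ bn]; first exact: linearP.
rewrite tconr_pure phi0 ?scale0r ?rpred0 //; exact: (fp_leq ltnd bn).
Qed.

Definition graded_tensors n : set (tensor B B) :=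
  [set t | exists i a b, [/\ (i <= n)%N, a \in F (n - i)%N, b \in F i & t = a \ox b]].

(** The right degree is peeled off from the top: after j steps the remainder lies in B (x)
    F_(n-j). *)
Lemma comul_graded n x : x \in F n -> comul x \in lspan (graded_tensors n).
Proof.
move=> xn; suff H j : (j <= n.+1)%N ->
    comul x \in lspan2 (lspan (graded_tensors n)) (tspan predT (fp (n.+1 - j))).
  have /lspan2P[t tn] := H _ (leqnn _); rewrite subnn => xt.
  rewrite -[comul x](subrK t) rpredD //; move: xt.
  apply: lspan_sub => _ [a [b [_ b0 ->]]]; move: b0.
  by rewrite mem_fil_pred0 => /eqP->; rewrite pure0r rpred0.
elim: j => [_|j IHj ltjn].
  by rewrite subn0; apply/mem_lspan2r/comul_tspan_cfil.
have /lspan2P[t tn xt] := IHj (ltnW ltjn).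
rewrite subSS; move: xt; have lejn : (j <= n)%N by [].
rewrite (subSn lejn); set i := (n - j)%N => xt.
have lein : (i <= n)%N by rewrite leq_subr.
rewrite -[comul x](subrK t) addrC rpredD //; first exact: mem_lspan2l.
(* Functionals that kill F_(i-1) contract the remainder into F_(n-i): on [comul x] by [coactr_fp],
   on [t] by the degrees of its terms. So the remainder lies in F_(n-i) (x) F_i modulo B (x)
   F_(i-1). *)
have := @tspan_contr _ _ _ (fp i) (F i) (F (n - i)%N) _ xt.
move=> /(_ _)/lspan2P[f f0|u uf tu].
  rewrite raddfB /= rpredB //.
    have := @coactr_fp n.+1 i x f f0 xn.
    by rewrite subSn.
  move: t tn {xt}; apply: lspan_img => [|_ [l [a [b [ln an bl ->]]]]]; first exact: linearP.
  rewrite tconr_pure; have [ltli|leil] := ltnP l i.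
    by rewrite f0 ?scale0r ?rpred0 // (fp_leq ltli).
  rewrite rpredZ //; apply: (@fp_leq (n - l).+1 (n - i).+1) an.
  by rewrite ltnS leq_sub2l.
rewrite -[_ - t](subrK u) rpredD //.
  apply: mem_lspan2l; move: tu; apply: lspan_sub => _ [a [b [an bi ->]]].
  by apply: mem_lspan; exists i, a, b.
exact: mem_lspan2r.
Qed.

(* Modulo 1 (x) B, the comultiplication of the commutator consists of terms whose
   right factors are commutators of lower total degree or lie in F_(m-1) F_(n-1). *)
Lemma comm_fp m n x y : x \in F m -> y \in F n -> x * y - y * x \in fp (m + n).
Proof.
have [N] := ubnP (m + n)%N; elim: N => // N IHN in m n x y *.
case: m => [_|m].
  move=> /(coradical_scalar cB)[a ->] _.
  by rewrite -scalerAl -scalerAr mul1r mulr1 subrr rpred0.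
case: n => [_|n lemn] xm.
  move=> /(coradical_scalar cB)[a ->].
  by rewrite -scalerAl -scalerAr mul1r mulr1 subrr rpred0.
move=> yn; have [g gm gP] := comul_cfil cB xm; have [h hn hP] := comul_cfil cB yn.
rewrite addSn; apply: fp_coactl => f f1; rewrite addnS.
have xyE : comul (x * y - y * x) = tcomm (comul x) (comul y).
  by rewrite raddfB /= !comulM.
rewrite /coactl /= xyE -[comul x](subrK (1 \ox g)) -[comul y](subrK (1 \ox h)).
move: (comul x - _) (comul y - _) gP hP => s t sP tP.
have lt1 : (m.+1 + n < N)%N by move: lemn; rewrite addnS ltnS.
have lt2 : (n.+1 + m < N)%N by move: lemn; rewrite addSn addnS ltnS addSn addnC.
have st : tcomm s t \in tspan predT (F (m + n)).
  rewrite /tcomm rpredB //.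
    by apply: tmul_tspan sP tP => a b am bn; exact: coradical_filM am bn.
  by apply: tmul_tspan tP sP => a b am bn; have := coradical_filM cB am bn; rewrite addnC.
have gt : tcomm (1 \ox g) t \in tspan predT (F (m + n)).
  by apply: tcomm1_tspan tP => b bn; apply: (IHN m.+1 n).
have sh : tcomm s (1 \ox h) \in tspan predT (F (m + n)).
  rewrite tcommC rpredN; apply: tcomm1_tspan sP => b bn.
  by have := IHN n.+1 m h b lt2 hn bn; rewrite addSn addnC.
have ghE : tconl f (tcomm (1 \ox g) (1 \ox h)) = 0.
  by rewrite /tcomm !tmul_pure !mul1r raddfB /= !tconl_pure f1 !scale0r subrr.
rewrite !(tcommDl, tcommDr) addrA.
move: (tcomm (1 \ox g) (1 \ox h)) ghE => w w0; rewrite (raddfD (tconl f)) /= w0 addr0.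
suff : tcomm s t + tcomm s (1 \ox h) + tcomm (1 \ox g) t \in tspan predT (F (m + n)).
  apply: tspan_img => [|a b _ bn]; first exact: linearP.
  by rewrite tconl_pure rpredZ.
by rewrite rpredD // rpredD.
Qed.

End ConnectedFiltration.

(** * The associated graded algebra and its derivations *)

Section GradedElements.
Context {k : fieldType} {A : algType k} (F : filtration A).
Local Notation fp := (fil_pred F).
Local Notation "\pi[ n ] x" := (\pi_(quotm (fp n)) x) (at level 10, x at level 9).

Lemma pi_fp_eq n x y : x - y \in fp n -> \pi[n] x = \pi[n] y.
Proof. by rewrite -quotm_eq => /eqP. Qed.

Lemma repr_pi_fp n x : repr (\pi[n] x) - x \in fp n.
Proof. by rewrite -quotm_eq reprK. Qed.

Lemma pi_fp0 n x : x \in fp n -> \pi[n] x = 0.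
Proof. by rewrite -quotm_eq0 => /eqP. Qed.

Lemma grh_axiom n x :
  gr_axiom (fun m => \pi[m] (if (m == n) && (x \in F n) then x else 0)).
Proof.
split; first by exists n.+1 => m /gtn_eqF->; rewrite pi_fp0 ?rpred0.
move=> m; exists (if (m == n) && (x \in F n) then x else 0) => //.
have [-> /=|_ /=] := eqVneq m n; last exact: rpred0.
by have [|_] := boolP (x \in F n); rewrite ?rpred0.
Qed.

(* The class of x in F_n / F_(n-1), and 0 when x is not in F_n. *)
Definition grh (n : nat) x : gr F := Gr (grh_axiom n x).

Lemma grhE n x m : x \in F n -> grh n x m = \pi[m] (if m == n then x else 0).
Proof. by move=> xn; rewrite /= xn andbT. Qed.

Lemma grh_eq0 n x : x \in fp n -> grh n x = 0.
Proof.
move=> xn; apply: gr_eq => m; rewrite /=.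
have [-> /=|_ /=] := eqVneq m n; last by rewrite pi_fp0 ?rpred0.
by rewrite fil_predW // pi_fp0.
Qed.

Lemma grh0 n : grh n 0 = 0.
Proof. by rewrite grh_eq0 ?rpred0. Qed.

Lemma grh_linear n a x y : x \in F n -> y \in F n ->
  grh n (a *: x + y) = a *: grh n x + grh n y.
Proof.
move=> xn yn; apply: gr_eq => m.
change (grh n (a *: x + y) m = a *: (grh n x m) + grh n y m).
rewrite !grhE ?rpredD ?rpredZ //; case: eqP => _; last by rewrite raddf0 scaler0 addr0.
by rewrite linearP.
Qed.

Lemma grhD n x y : x \in F n -> y \in F n -> grh n (x + y) = grh n x + grh n y.
Proof. by move=> xn yn; rewrite -[x]scale1r grh_linear // !scale1r. Qed.

Lemma grh_congr n x y : y \in F n -> x - y \in fp n -> grh n x = grh n y.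
Proof.
move=> yn xy; rewrite -[x](subrK y) grhD ?(grh_eq0 xy) ?add0r //.
exact: fil_predW xy.
Qed.

Lemma grh_sum n I (r : seq I) (c : I -> k) (x : I -> A) :
  (forall i, x i \in F n) ->
  grh n (\sum_(i <- r) c i *: x i) = \sum_(i <- r) c i *: grh n (x i).
Proof.
move=> xF; elim: r => [|i r IHr]; first by rewrite !big_nil grh_eq0 ?rpred0.
by rewrite !big_cons grh_linear ?IHr // rpred_sum // => j _; rewrite rpredZ.
Qed.

Lemma grhM m n x y : x \in F m -> y \in F n -> grh m x * grh n y = grh (m + n)%N (x * y).
Proof.
move=> xm yn; apply: gr_eq => p.
rewrite [RHS]grhE ?filM //.
rewrite [LHS](@grME _ _ _ (grh m x) (grh n y) (fun i => if i == m then x else 0)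
  (fun i => if i == n then y else 0)); first last.
- by move=> i; rewrite grhE.
- by move=> i; case: eqP => [->|_]; rewrite ?rpred0.
- by move=> i; rewrite grhE.
- by move=> i; case: eqP => [->|_]; rewrite ?rpred0.
congr (\pi[p] _); have [lemp|ltpm] := leqP m p; last first.
  rewrite big1 => [|i _]; last first.
    by rewrite ltn_eqF ?mul0r // (leq_ltn_trans (leq_ord i)).
  by rewrite ltn_eqF // ltn_addr.
rewrite (bigD1 (Ordinal (lemp : (m < p.+1)%N))) //= eqxx big1 ?addr0.
  rewrite -(eqn_add2l m) subnKC //; by case: eqP => // _; rewrite mulr0.
by move=> i; rewrite -val_eqE /= => /negPf->; rewrite mul0r.
Qed.

Lemma gr1E : 1 = grh 0 1.
Proof. by apply: gr_eq => m; rewrite grhE ?fil1. Qed.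

Lemma gr_sumE I (r : seq I) (f : I -> gr F) m : (\sum_(i <- r) f i) m = \sum_(i <- r) f i m.
Proof.
elim: r => [|i r IHr]; first by rewrite !big_nil.
by rewrite !big_cons -IHr.
Qed.

Lemma gr_decomp (f : gr F) : exists N, f = \sum_(i < N) grh i (repr (f i)).
Proof.
have [[N fN] _] := grP f; exists N; apply: gr_eq => m.
rewrite gr_sumE; under eq_bigr => i _ do rewrite grhE ?gr_repr //.
have [ltmN|leNm] := ltnP m N.
  rewrite (bigD1 (Ordinal ltmN)) //= eqxx reprK big1 ?addr0 // => i.
  by rewrite -val_eqE /= eq_sym => /negPf->; rewrite raddf0.
rewrite fN // big1 // => i _.
by rewrite gtn_eqF ?raddf0 // (leq_trans (ltn_ord i)).
Qed.

Lemma gr_ind (P : gr F -> Prop) : P 0 -> (forall f g, P f -> P g -> P (f + g)) ->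
  (forall n x, x \in F n -> P (grh n x)) -> forall f, P f.
Proof.
move=> P0 PD Ph f; have [N ->] := gr_decomp f.
by elim/big_rec: _ => // i g _; apply: PD; apply: Ph; apply: gr_repr.
Qed.

End GradedElements.

Section GradedDerivation.
Context {k : fieldType} {B : bialgType k} (cB : connected_coalg B).
Local Notation F := (coradical_filtration cB).
Local Notation fp := (fil_pred F).
Local Notation "\pi[ n ] x" := (\pi_(quotm (fp n)) x) (at level 10, x at level 9).

(** For d > 0, F_d modulo this subspace is the degree-d part of K+ / (K+)^2, where K+ is the
    augmentation ideal of K. *)
Definition decomposables d : subspace B :=
  lspan [set x | x \in fp d \/ exists i j a b,
    [/\ (0 < i)%N && (0 < j)%N, (i + j = d)%N, a \in F i, b \in F j & x = a * b]].

Context {d : nat} {phi : {scalar B}}.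
Hypothesis phiQ : forall x, x \in decomposables d -> phi x = 0.

Lemma infinitesimal_fp y : y \in fp d -> phi y = 0.
Proof. by move=> yd; apply/phiQ/mem_lspan; left. Qed.

Lemma infinitesimalM i j a b : (0 < i)%N -> (0 < j)%N -> (i + j = d)%N ->
  a \in F i -> b \in F j -> phi (a * b) = 0.
Proof.
move=> i0 j0 ijd ai bj; apply/phiQ/mem_lspan; right.
by exists i, j, a, b; rewrite i0 j0.
Qed.

Lemma infinitesimal_lt i y : (i < d)%N -> y \in F i -> phi y = 0.
Proof. by move=> ltid yi; apply: infinitesimal_fp; apply: (@fp_leq _ _ cB i.+1). Qed.

Lemma infinitesimal_coactr n x : x \in fp (n + d) -> coactr phi x \in fp n.
Proof. by move=> xn; rewrite -[n](addnK d); apply: coactr_fp xn; exact: infinitesimal_fp. Qed.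

Lemma graded_derivation_axiom (f : gr F) :
  gr_axiom (fun n => \pi[n] (coactr phi (repr (f (n + d)%N)))).
Proof.
have [[N fN] _] := grP f; split.
  exists N => n leNn; rewrite fN; last by rewrite (leq_trans leNn) ?leq_addr.
  rewrite pi_fp0 //; apply: infinitesimal_coactr.
  by rewrite -quotm_eq0 reprK.
move=> n; exists (coactr phi (repr (f (n + d)%N))) => //.
have := coactr_fp infinitesimal_fp (gr_repr f (n + d) : _ \in fp (n + d).+1).
by rewrite -addSn addnK.
Qed.

Definition graded_derivation f : gr F := Gr (graded_derivation_axiom f).

Lemma graded_derivation_is_linear : linear graded_derivation.
Proof.
move=> a f g; apply: gr_eq => n.
change (\pi[n] (coactr phi (repr ((a *: f + g) (n + d)%N))) =
  a *: \pi[n] (coactr phi (repr (f (n + d)%N))) + \pi[n] (coactr phi (repr (g (n + d)%N)))).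
rewrite -linearP; apply: pi_fp_eq; rewrite -linearP -raddfB /=.
apply: infinitesimal_coactr.
by rewrite -quotm_eq linearP /= !reprK.
Qed.

HB.instance Definition _ := GRing.isLinear.Build k (gr F) (gr F) *:%R
  graded_derivation graded_derivation_is_linear.

Lemma graded_derivation_hom n x : x \in F n ->
  graded_derivation (grh F n x) = grh F (n - d)%N (coactr phi x).
Proof.
move=> xn; have Dx : coactr phi x \in fp (n.+1 - d).
  by apply: coactr_fp => //; exact: infinitesimal_fp.
apply: gr_eq => m; transitivity (\pi[m] (coactr phi (if (m + d)%N == n then x else 0))).
  rewrite /= xn andbT; apply: pi_fp_eq; rewrite -raddfB.
  by apply: infinitesimal_coactr; exact: repr_pi_fp.
have [ledn|ltnd] := leqP d n.
  move: Dx; rewrite subSn // => Dx; rewrite grhE //.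
  rewrite -[in LHS](subnK ledn) eqn_add2r.
  by case: eqP => // _; rewrite raddf0.
(* For n < d the truncated [n - d] is 0, but [Dx] then puts [coactr phi x] in [fp 0], so both sides
   vanish. *)
move: Dx; rewrite (eqP (ltnd : n.+1 - d == 0)%N) => Dx.
rewrite grh_eq0; last by rewrite (eqP (ltnW ltnd : n - d == 0)%N).
by rewrite gtn_eqF ?raddf0 // (leq_trans ltnd) ?leq_addl.
Qed.

(** When s and t are the comultiplications of x and y, this is D (x y) - x (D y) - (D x) y with D =
    [coactr phi]. Stated for tensors, it is bilinear and can be checked on pure ones. *)
Definition leibniz_defect (s t : tensor B B) : B :=
  tconr phi (tmul s t) - tconr counit s * tconr phi t - tconr phi s * tconr counit t.

Lemma leibniz_defectr s : linear (leibniz_defect s).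
Proof.
move=> a t u; rewrite /leibniz_defect tmul_linearr !linearP /=.
by rewrite !mulrDr -!scalerAr !opprD !scalerBr [X in X + _ = _]addrACA [LHS]addrACA.
Qed.

Lemma leibniz_defectl t : linear (leibniz_defect^~ t).
Proof.
move=> a s u; rewrite /leibniz_defect tmul_linearl !linearP /=.
by rewrite !mulrDl -!scalerAl !opprD !scalerBr [X in X + _ = _]addrACA [LHS]addrACA.
Qed.

(* On a (x) b and a' (x) b' the defect is a a' times
   phi (b b') - eps b phi b' - phi b eps b', which vanishes unless the degrees
   of b and b' add up to more than d. *)
Lemma leibniz_defect_fp m n s t : (0 < d)%N -> s \in lspan (graded_tensors cB m) ->
  t \in lspan (graded_tensors cB n) -> leibniz_defect s t \in fp (m + n - d).
Proof.
move=> d0 sm tn; move: s sm; apply: lspan_img => [|s].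
  exact: leibniz_defectl.
move=> [i [a [b [lim am bi ->]]]]; move: t tn; apply: lspan_img => [|t].
  exact: leibniz_defectr.
move=> [j [a' [b' [ljn an bj ->]]]].
have phi1 c : phi (c *: 1) = 0.
  by apply: (infinitesimal_lt d0); apply: coradical_scale.
have scM (x y : k) : (x *: a) * (y *: a') = (x * y) *: (a * a').
  by rewrite -scalerAl -scalerAr scalerA.
rewrite /leibniz_defect tmul_pure !tconr_pure !scM -!scalerBl.
have [ltd|led] := ltnP d (i + j)%N.
  rewrite rpredZ //; apply: (@fp_leq _ _ cB (m - i + (n - j)).+1); last exact: filM.
  lia.
suff -> : phi (b * b') - counit b * phi b' - phi b * counit b' = 0.
  by rewrite scale0r rpred0.
case: i lim am bi led => [|i] lim am bi led.
  have [c ->] := coradical_scalar cB bi.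
  rewrite phi1 mul0r subr0 !linearZ /= counit1 -scalerAl mul1r linearZ.
  by rewrite mulr1 subrr.
case: j ljn an bj led => [|j] ljn an bj led.
  have [c ->] := coradical_scalar cB bj.
  rewrite phi1 mulr0 subr0 !linearZ /= counit1 -scalerAr mulr1 linearZ /=.
  by rewrite mulr1 [_ * c]mulrC subrr.
have ltid : (i.+1 < d)%N by rewrite (leq_trans _ led) // -addn1 leq_add2l.
have ltjd : (j.+1 < d)%N by rewrite (leq_trans _ led) // -add1n leq_add2r.
rewrite (infinitesimal_lt ltid bi) (infinitesimal_lt ltjd bj) mulr0 mul0r !subr0.
move: led; rewrite leq_eqVlt => /predU1P[dE|ltd].
  exact: (infinitesimalM _ _ dE bi bj).
by apply: (infinitesimal_lt ltd); apply: filM.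
Qed.

Lemma graded_derivationM : (0 < d)%N -> forall f g : gr F,
  graded_derivation (f * g) = f * graded_derivation g + graded_derivation f * g.
Proof.
move=> d0 f g.
move: f; apply: gr_ind => [|f f' Hf Hf'|m x xm].
- by rewrite raddf0 !mul0r raddf0 addr0.
- by rewrite mulrDl !raddfD /= Hf Hf' !mulrDl addrACA.
move: g; apply: gr_ind => [|g g' Hg Hg'|n y yn].
- by rewrite raddf0 !mulr0 raddf0 addr0.
- by rewrite mulrDr !raddfD /= Hg Hg' !mulrDr addrACA.
have Dxy := leibniz_defect_fp d0 (comul_graded xm) (comul_graded yn).
rewrite grhM // !graded_derivation_hom ?filM //.
(* Truncated subtraction again: [coactr phi] is zero in degrees below d, so the two products below
   have degree m + n - d in every case. *)
have D0 z p : z \in F p -> (p < d)%N -> coactr phi z = 0.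
  move=> zp ltpd; apply/eqP; rewrite -(mem_fil_pred0 F).
  have <- : (p.+1 - d = 0)%N by apply/eqP.
  by apply: coactr_fp => //; exact: infinitesimal_fp.
have DF z p : z \in F p -> coactr phi z \in F (p - d)%N.
  move=> zp; have [ledp|ltpd] := leqP d p; last by rewrite (D0 z p) ?rpred0.
  have := coactr_fp infinitesimal_fp (zp : _ \in fp p.+1); by rewrite subSn.
have -> : grh F m x * grh F (n - d)%N (coactr phi y) = grh F (m + n - d)%N (x * coactr phi y).
  have [ledn|ltnd] := leqP d n; first by rewrite grhM ?DF // addnBA.
  by rewrite (D0 y n) // mulr0 !grh0 mulr0.
have -> : grh F (m - d)%N (coactr phi x) * grh F n y = grh F (m + n - d)%N (coactr phi x * y).
  have [ledm|ltmd] := leqP d m; first by rewrite grhM ?DF // addnBAC.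
  by rewrite (D0 x m) // mul0r !grh0 mul0r.
have xyF : x * coactr phi y \in F (m + n - d)%N.
  have [ledn|ltnd] := leqP d n; last by rewrite (D0 y n) // mulr0 rpred0.
  by rewrite -addnBA // filM ?DF.
have yxF : coactr phi x * y \in F (m + n - d)%N.
  have [ledm|ltmd] := leqP d m; last by rewrite (D0 x m) // mul0r rpred0.
  by rewrite -addnBAC // filM ?DF.
rewrite -grhD //; apply: grh_congr; first exact: rpredD.
move: Dxy; rewrite /leibniz_defect -comulM.
rewrite -[tconr counit (comul x)]/(coactr counit x) -[tconr counit (comul y)]/(coactr counit y).
by rewrite !coactr_counit opprD addrA.
Qed.

End GradedDerivation.

(** * The coradical filtration is exhaustive *)

Section FiniteOrbits.
Context {k : fieldType}.

Lemma scalar_comb (V : lmodType k) a (f g : {scalar V}) :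
  exists h : {scalar V}, forall x, h x = a * f x + g x.
Proof.
pose h x := a * f x + g x; have hL : scalar h.
  by move=> c x y; rewrite /h !linearP /= !mulrDr mulrCA addrACA -mulrDr.
by exists (HB.pack_for {scalar V} h (GRing.isLinear.Build k V k *%R h hL)).
Qed.

Lemma tconl_comb (U V : lmodType k) a (f g h : {scalar U}) (t : tensor U V) :
  (forall x, h x = a * f x + g x) -> tconl h t = a *: tconl f t + tconl g t.
Proof.
move=> hE; move: t; apply: tensor_ind => [|b s t Hs Ht|u v].
- by rewrite !raddf0 ?scaler0 addr0.
- by rewrite !linearP /= Hs Ht !scalerDr !scalerA (mulrC b) addrACA.
- by rewrite !tconl_pure hE scalerDl scalerA.
Qed.

Context {C : coalgType k}.
Implicit Types f g : {scalar C}.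

(** With [P] trivial this is the subcomodule generated by [x]; the other choice made below is the
    set of functionals that kill 1. *)
Definition orbit_pred (P : {scalar C} -> Prop) (x : C) : {pred C} :=
  fun y => `[< exists2 f, P f & y = coactl f x >].

Lemma orbit_submod_closed P x :
  (exists f, P f) ->
  (forall a f g (h : {scalar C}), P f -> P g -> (forall x, h x = a * f x + g x) -> P h) ->
  submod_closed (orbit_pred P x).
Proof.
move=> [f0 Pf0] PD; split=> [|a y z /asboolP[f Pf ->] /asboolP[g Pg ->]].
  have [h hE] := scalar_comb (-1) f0 f0; apply/asboolP; exists h.
    exact: PD hE.
  by rewrite /coactl /= (tconl_comb _ hE) scaleN1r addNr.
have [h hE] := scalar_comb a f g; apply/asboolP; exists h; first exact: PD hE.
by rewrite /coactl /= (tconl_comb _ hE).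
Qed.

Lemma orbit_closed x : submod_closed (orbit_pred (fun=> True) x).
Proof. by apply: orbit_submod_closed => //; exists counit. Qed.

Definition orbit x : subspace C := Subspace (orbit_closed x).

Lemma orbitP x y : reflect (exists f, y = coactl f x) (y \in orbit x).
Proof.
by apply: (iffP (asboolP _)) => [[f _ ->]|[f ->]]; exists f.
Qed.

Lemma mem_orbit x : x \in orbit x.
Proof. by apply/orbitP; exists counit; rewrite coactl_counit. Qed.

Lemma orbit_coactl x y f : y \in orbit x -> coactl f y \in orbit x.
Proof. by move=> /orbitP[g ->]; rewrite coactlA; apply/orbitP; eexists. Qed.

Lemma comul_sum (x : C) : exists n (u v : 'I_n -> C), comul x = \sum_i u i \ox v i.
Proof. by have [n [u [v [_ _ ->]]]] := tspan_sum (mem_tspan_full (comul x)); exists n, u, v. Qed.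

(** Finiteness theorem for comodules: the right factors in one expression of [comul x] span a space
    that contains the orbit. *)
Lemma orbit_spanned x : exists n, spanned (orbit x) n.
Proof.
have [n [u [v xE]]] := comul_sum x; exists n, v => y /orbitP[f ->].
exists (f \o u); rewrite /coactl /= xE raddf_sum /=.
by apply: eq_bigr => i _; rewrite tconl_pure.
Qed.

Lemma orbit_sub x y : y \in orbit x -> {subset orbit y <= orbit x}.
Proof. by move=> yx z /orbitP[f ->]; apply: orbit_coactl. Qed.

Lemma coactr_sum x n (u v : 'I_n -> C) phi : comul x = \sum_i u i \ox v i ->
  coactr phi x = \sum_i phi (v i) *: u i.
Proof.
move=> xE; rewrite /coactr /= xE raddf_sum.
by apply: eq_bigr => i _; rewrite /= tconr_pure.
Qed.

(** It bounds the dimension of the coefficient coalgebra of a finite-dimensional subcomodule. *)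
Lemma coactr_seq (r : seq C) : exists s : seq C, forall y phi,
  y \in r -> coactr phi y \in lspan [set z | z \in s].
Proof.
elim: r => [|x r [s sP]]; first by exists [::].
have [n [u [v xE]]] := comul_sum x; exists (codom u ++ s) => y phi.
rewrite inE => /predU1P[->|yr]; last first.
  by move: (sP y phi yr); apply: lspan_sub => z zs; apply: mem_lspan => /=; rewrite mem_cat zs orbT.
rewrite (coactr_sum _ xE) rpred_sum // => i _.
by rewrite rpredZ // mem_lspan //= mem_cat codom_f.
Qed.

Lemma lspan_seq_spanned (V : lmodType k) (s : seq V) : spanned (lspan [set z | z \in s]) (size s).
Proof.
exists (fun i => s`_i) => v vs; apply/famspanP.
move: v vs; apply: lspan_sub => z /= /(nthP 0)[i lti <-].
by apply: mem_lspan; exists (Ordinal lti).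
Qed.

(** With the zero subspace [Z] as the killed part, contraction by all functionals moves first the
    right factors and then the left ones into [D]. *)
Lemma subcoalgebra_crit (D : subspace C) :
  (forall f x, x \in D -> coactl f x \in D) ->
  (forall f x, x \in D -> coactr f x \in D) -> subcoalgebra D.
Proof.
move=> Dl Dr x xD; pose Z : subspace C := famspan (fun _ : 'I_0 => 0).
have Z0 z : z \in Z -> z = 0 by move=> /famspanP[c ->]; rewrite big_ord0.
have cl : comul x \in tspan predT D.
  have /lspan2P[s sZ st] := @tspan_contl _ _ _ Z (fullspace C) D _ (mem_tspan_full (comul x))
    (fun f _ => Dl f x xD).
  rewrite -[comul x](subrK s) rpredD //.
  by move: s sZ {st}; apply: lspan_sub => _ [d [e [/Z0-> _ ->]]]; rewrite pure0l rpred0.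
have /lspan2P[s sZ st] := @tspan_contr _ _ _ Z D D _ cl (fun f _ => Dr f x xD).
rewrite -[comul x](subrK s) rpredD //.
by move: s sZ {st}; apply: lspan_sub => _ [d [e [_ /Z0-> ->]]]; rewrite pure0r rpred0.
Qed.

(** A nonzero subcoalgebra of least dimension inside [D] is simple. *)
Lemma simple_sub_exists (D : subspace C) r z : subcoalgebra D -> spanned D r ->
    z \in D -> z != 0 ->
  exists2 E : subspace C, simple_subcoalgebra E & {subset E <= D}.
Proof.
move=> cD sD zD z0.
pose P d : bool := `[< exists E : subspace C, [/\ subcoalgebra E, {subset E <= D},
  exists2 x, x \in E & x != 0 & has_dim E d] >].
have P0 : exists d, P d.
  have [d _ Dd] := spanned_has_dim sD.
  by exists d; apply/asboolP; exists D; split=> //; exists z.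
have [d /asboolP[E [cE ED E0 Ed]] dmin] := ex_minnP P0.
exists E => //; split=> // G cG GE.
have [[y yG y0]|G0] := pselect (exists2 y, y \in G & y != 0); last first.
  left=> y yG; apply/eqP; apply: contrapT => /negP y0; apply: G0; by exists y.
right; have [d' Gd' [//|]] := has_dim_sub GE Ed.
rewrite ltnNge; case/negP; apply: dmin; apply/asboolP; exists G.
by split=> // [x /GE/ED|]; [|exists y].
Qed.

End FiniteOrbits.

Section Exhaustive.
Context {k : fieldType} {B : bialgType k} (cB : connected_coalg B).
Local Notation F := (coradical_filtration cB).
Local Notation fp := (fil_pred F).
Implicit Types f e phi : {scalar B}.

Lemma F_leq m n : (m <= n)%N -> {subset F m <= F n}.
Proof. by move=> mn; apply: (@fp_leq _ _ cB m.+1 n.+1). Qed.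

Definition Fcup_pred : {pred B} := fun x => `[< exists n, x \in F n >].

Lemma Fcup_closed : submod_closed Fcup_pred.
Proof.
split=> [|a x y /asboolP[m xm] /asboolP[n yn]]; apply/asboolP.
  by exists 0%N; rewrite rpred0.
exists (maxn m n); rewrite rpredD ?rpredZ //.
  exact: F_leq (leq_maxl _ _) _ xm.
exact: F_leq (leq_maxr _ _) _ yn.
Qed.

Definition Fcup : subspace B := Subspace Fcup_closed.

Lemma FcupP x : reflect (exists n, x \in F n) (x \in Fcup).
Proof. exact: asboolP. Qed.

Lemma Fcup_coactl f x : x \in Fcup -> coactl f x \in Fcup.
Proof.
move=> /FcupP[n xn]; apply/FcupP; exists n.
move: (comul_tspan_cfil xn); apply: tspan_img => [|a b _ bn]; first exact: linearP.
by rewrite tconl_pure rpredZ.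
Qed.

Lemma Fcup_coactr phi x : (forall y, y \in Fcup -> phi y = 0) -> x \in Fcup ->
  coactr phi x = 0.
Proof.
move=> phi0 /FcupP[n xn]; apply/eqP; rewrite -(mem_fil_pred0 F).
change (tconr phi (comul x) \in fp 0).
move: (comul_tspan_cfil xn); apply: tspan_img => [|a b _ bn]; first exact: linearP.
by rewrite tconr_pure phi0 ?scale0r ?rpred0 //; apply/FcupP; exists n.
Qed.

Lemma finite_Fcup (U : subspace B) d : has_dim U d -> {subset U <= Fcup} ->
  exists n, {subset U <= F n}.
Proof.
move=> [b [_ bU]] UM.
have /choice[n nP] i : exists n, b i \in F n by apply/FcupP/UM/(has_dim_mem _ bU).
exists (\max_i n i)%N => x /bU[c ->]; rewrite rpred_sum // => i _; rewrite rpredZ //.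
exact: F_leq (leq_bigmax i) _ (nP i).
Qed.

(* The orbit of x is finite-dimensional, so a single F n contains all coactl f x. *)
Lemma Fcup_crit x : (forall f, f 1 = 0 -> coactl f x \in Fcup) -> x \in Fcup.
Proof.
move=> xM; pose P f := f (1 : B) = 0.
have cI : submod_closed (orbit_pred P x).
  apply: orbit_submod_closed.
    have [h hE] := scalar_comb (-1) (counit : {scalar B}) counit.
    by exists h; rewrite /P hE mulN1r addNr.
  by rewrite /P => a f g h f0 g0 ->; rewrite f0 g0 mulr0 addr0.
have [r sr] := orbit_spanned x.
have sI : spanned (Subspace cI) r.
  have [b bP] := sr; exists b => y /asboolP[f _ yE]; apply: bP.
  by apply/orbitP; exists f.
have [d _ Id] := spanned_has_dim sI.
have [|n In] := finite_Fcup Id; first by move=> y /asboolP[f f1 ->]; apply: xM.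
apply/FcupP; exists n.+1; apply: (@fp_coactl _ _ cB n.+1) => f f1; apply: In.
by apply/asboolP; exists f.
Qed.

Section Density.
Variables (N : subspace B) (n : nat) (T : ('I_n -> B) -> Prop).
Hypothesis Nsimple : forall y z, y \in N -> y \notin Fcup -> z \in N ->
  exists f, z - coactl f y \in Fcup.
Hypothesis TN : forall s, T s -> forall i, s i \in N.
Hypothesis TM : forall s, (forall i, s i \in Fcup) -> T s.
Hypothesis TD : forall a s t, T s -> T t -> T (fun i => a *: s i + t i).
Hypothesis TA : forall f s, T s -> T (fun i => coactl f (s i)).

(* Jacobson density for tuples in the simple comodule N / Fcup, one coordinate
   at a time. *)
Lemma density s : (forall i, s i \in N) ->
  (forall f, f 1 = 0 -> T (fun i => coactl f (s i))) -> T s.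
Proof.
suff H j : (j <= n)%N -> forall s, (forall i, s i \in N) ->
    (forall i : 'I_n, (j <= i)%N -> s i \in Fcup) ->
    (forall f, f 1 = 0 -> T (fun i => coactl f (s i))) -> T s.
  move=> sN; apply: (H n) => // i; by rewrite leqNgt ltn_ord.
elim: j => [_|j IHj ltjn] {}s sN sM sT; first by apply: TM => i; apply: sM.
pose i0 := Ordinal ltjn.
have split_i (i : 'I_n) : (j <= i)%N -> i = i0 \/ (j < i)%N.
  by rewrite leq_eqVlt => /predU1P[ji|]; [left; apply: val_inj|right].
(* Either some tuple of [T] is nonzero modulo Fcup at j and zero beyond j, and by simplicity a
   functional carries it to a tuple that clears coordinate j of [s]; or there is none, and then
   [Fcup_crit] puts that coordinate in Fcup, since a value of [coactl f] outside Fcup would yield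
   such a tuple. *)
have [[t [Tt tM t0]]|noT] := pselect (exists t, [/\ T t,
    forall i : 'I_n, (j < i)%N -> t i \in Fcup & t i0 \notin Fcup]).
  have [f fP] := Nsimple (TN Tt i0) t0 (sN i0).
  pose u := fun i => coactl f (t i); have Tu : T u by apply: TA.
  have -> : s = (fun i => 1 *: u i + (s i - u i)).
    by apply/funext => i; rewrite scale1r addrC subrK.
  apply: TD => //; apply: IHj; first exact: ltnW.
  - by move=> i; rewrite rpredB ?sN ?TN.
  - move=> i /split_i[->//|ji]; rewrite rpredB ?sM //.
    by apply/Fcup_coactl/tM.
  move=> g g1; have -> : (fun i => coactl g (s i - u i)) =
      (fun i => -1 *: coactl g (u i) + coactl g (s i)).
    by apply/funext => i; rewrite raddfB /= scaleN1r addrC.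
  by apply: TD; [apply: TA|apply: sT].
apply: (IHj (ltnW ltjn)) => // i /split_i[->|]; last exact: sM.
apply: Fcup_crit => f f1; apply: contrapT => /negP fN; apply: noT.
exists (fun i => coactl f (s i)); split=> //; first exact: sT.
by move=> l jl; apply/Fcup_coactl/sM.
Qed.

End Density.

(* Otherwise take x outside the union with an orbit L of least dimension, so that
   L is simple modulo the union M. By density some e with e 1 = 0 acts as the
   identity on L / M, so e agrees with the counit on the coefficient coalgebra of
   L / M; but that coalgebra contains a simple one, hence 1. *)
Lemma coradical_fil_exhaustive (x : B) : exists n, x \in F n.
Proof.
apply/FcupP; apply: contrapT => /negP xM.
pose P d : bool := `[< exists2 y, y \notin Fcup & has_dim (orbit y) d >].
have P0 : exists d, P d.
  have [r sr] := orbit_spanned x; have [d _ xd] := spanned_has_dim sr.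
  by exists d; apply/asboolP; exists x.
have [d /asboolP[{xM}x xM xd] dmin] := ex_minnP P0.
pose L := orbit x; pose N := lspan2 L Fcup.
have LN : {subset L <= N} by apply: mem_lspan2l.
have MN : {subset Fcup <= N} by apply: mem_lspan2r.
have Lsimple y : y \in L -> y \notin Fcup -> {subset L <= orbit y}.
  move=> yL yM; have [d' yd' [//|]] := has_dim_sub (orbit_sub yL) xd.
  by rewrite ltnNge; case/negP; apply: dmin; apply/asboolP; exists y.
have Nsimple y z : y \in N -> y \notin Fcup -> z \in N -> exists f, z - coactl f y \in Fcup.
  move=> /lspan2P[l lL lM] yM /lspan2P[l' lL' lM'].
  have lN : l \notin Fcup.
    by apply: contraNN yM => lF; rewrite -[y](subrK l) rpredD.
  have /orbitP[f fE] := Lsimple l lL lN l' lL'; exists f.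
  rewrite -[z](subrK l') -addrA rpredD // fE -raddfB -opprB raddfN rpredN.
  exact: Fcup_coactl.
have [b [_ bL]] := xd.
have bN i : b i \in N by apply/LN/(has_dim_mem _ bL).
have NA f y : y \in N -> coactl f y \in N.
  move=> /lspan2P[l lL lM]; rewrite -[y](subrK l) raddfD rpredD //.
    exact/MN/Fcup_coactl.
  exact/LN/orbit_coactl.
pose T (t : 'I_d -> B) := exists2 e : {scalar B}, e 1 = 0 & forall i, t i - coactl e (b i) \in Fcup.
have [e e1 eP] : T b.
  apply: (@density N) => //.
  - move=> s [e _ eP] i; rewrite -[s i](subrK (coactl e (b i))) rpredD ?NA //.
    exact: MN.
  - move=> s sM; have [h hE] := scalar_comb (-1) (counit : {scalar B}) counit.
    exists h => [|i]; first by rewrite hE mulN1r addNr.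
    by rewrite /coactl /= (tconl_comb _ hE) scaleN1r addNr subr0.
  - move=> a s t [e e1 eP] [f f1 fP]; have [h hE] := scalar_comb a e f.
    exists h => [|i]; first by rewrite hE e1 f1 mulr0 addr0.
    rewrite /coactl /= (tconl_comb _ hE) opprD addrACA -scalerBr.
    by rewrite rpredD ?rpredZ ?eP ?fP.
  - move=> f s [e e1 eP]; exists (f \o coactl e).
      by rewrite /= coactl1 e1 scale0r raddf0.
    by move=> i; rewrite -coactlA -raddfB Fcup_coactl.
  - by move=> f f1; exists f => // i; rewrite subrr rpred0.
have eL y : y \in L -> y - coactl e y \in Fcup.
  move=> /bL[c ->]; rewrite raddf_sum -sumrB rpred_sum // => i _ /=.
  by rewrite linearZ /= -scalerBr rpredZ.
pose C := lspan [set c | exists phi y,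
  [/\ forall m, m \in Fcup -> phi m = 0, y \in L & c = coactr phi y]].
have eC c : c \in C -> e c = counit c.
  move: c; apply: lspan_ind => [|a u v eu ev|_ [phi [y [phi0 yL ->]]]].
  - by rewrite !raddf0.
  - by rewrite !linearP /= eu ev.
  rewrite fun_coact counit_coactr; apply/eqP.
  by rewrite eq_sym -subr_eq0 -raddfB /= phi0 ?eL.
have cC : subcoalgebra C.
  apply: subcoalgebra_crit => f.
    apply: lspan_img => [|_ [phi [y [phi0 yL ->]]]]; first exact: linearP.
    rewrite coactC; apply: mem_lspan; exists phi, (coactl f y).
    by rewrite orbit_coactl.
  apply: lspan_img => [|_ [phi [y [phi0 yL ->]]]]; first exact: linearP.
  rewrite coactrA; apply: mem_lspan; exists (f \o coactr phi), y; split=> // m mM.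
  by rewrite /= Fcup_coactr // raddf0.
have [s sP] := coactr_seq (codom b).
have sC : spanned C (size s).
  have [v vP] := lspan_seq_spanned s; exists v => c cCc; apply: vP.
  move: c cCc; apply: lspan_sub => _ [phi [y [_ /bL[a ->] ->]]].
  rewrite raddf_sum rpred_sum // => i _ /=.
  by rewrite linearZ rpredZ // sP ?codom_f.
have [phi phi0 phix] := functional_sep xM.
have cx : coactr phi x \in C.
  by apply: mem_lspan; exists phi, x; split=> //; apply: mem_orbit.
have cx0 : coactr phi x != 0.
  apply: contra_eq_neq phix => cx0.
  by rewrite -counit_coactr cx0 raddf0 eq_sym oner_eq0.
have [E Esimple EC] := simple_sub_exists cC sC cx cx0.
have [_ [z zE z0] _] := Esimple.
have [a zE'] : exists a, z = a *: 1.
  by apply: (coradical_scalar cB); apply: mem_lspan; exists E.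
have := eC z (EC z zE); rewrite zE' !linearZ /= e1 counit1 mulr0 mulr1 => a0.
by move: z0; rewrite zE' -a0 scale0r eqxx.
Qed.

End Exhaustive.

(** * Algebraic independence *)

Section Evaluation.
Context {k : fieldType} {A : algType k} {n : nat}.
Implicit Types (x : 'I_n -> A) (P : mpoly n k) (m : multinom n).

(** [A] may be noncommutative: [mmap1] multiplies the powers in the order of the indices, and
    multiplicativity is claimed only for commutative [A] ([meval_algM]). *)
Definition meval_alg x : mpoly n k -> A := mmap (@GRing.in_alg k A) x.

Lemma meval_alg_is_linear x : linear (meval_alg x).
Proof.
by move=> a P Q; rewrite /meval_alg mmapD mmapZ /= -scalerAl mul1r.
Qed.

HB.instance Definition _ x := GRing.isLinear.Build k (mpoly n k) A *:%R
  (meval_alg x) (meval_alg_is_linear x).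

Lemma meval_algX x m : meval_alg x (mpolyX k m) = mmap1 x m.
Proof. exact: mmapX. Qed.

Lemma meval_algE x P : meval_alg x P = \sum_(m <- msupp P) mcoeff m P *: mmap1 x m.
Proof.
rewrite /meval_alg /mmap; apply: eq_bigr => m _.
by rewrite /= -scalerAl mul1r.
Qed.

Lemma meval_alg1 x : meval_alg x 1 = 1.
Proof. by rewrite -mpolyC1 /meval_alg mmapC /= scale1r. Qed.

Lemma meval_algXU x i : meval_alg x (mpolyX k (mnm1 i)) = x i.
Proof. by rewrite meval_algX mmap1U. Qed.

End Evaluation.

Section Derivations.
Context {k : fieldType} {A : comAlgType k} {n : nat}.
Implicit Types (x : 'I_n -> A) (P Q : mpoly n k).

Lemma meval_algM x P Q : meval_alg x (P * Q) = meval_alg x P * meval_alg x Q.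
Proof. exact: (mmap_is_multiplicative x (@GRing.in_alg k A)).1. Qed.

Lemma derivation_meval (D : {linear A -> A}) x P :
    (forall f g, D (f * g) = f * D g + D f * g) ->
  D (meval_alg x P) = \sum_i meval_alg x (mderiv i P) * D (x i).
Proof.
move=> DM.
have D1 : D 1 = 0.
  by have /eqP := DM 1 1; rewrite !mulr1 mul1r -subr_eq0 opprD addNKr oppr_eq0 => /eqP.
(* The chain rule is stable under products, so monomials reduce to 1 and the variables. *)
pose chain Q := D (meval_alg x Q) = \sum_i meval_alg x (mderiv i Q) * D (x i).
have chainM Q R : chain Q -> chain R -> chain (Q * R).
  rewrite /chain meval_algM DM => -> ->.
  rewrite mulr_sumr mulr_suml -big_split; apply: eq_bigr => i _ /=.
  rewrite mderivM raddfD /= !meval_algM mulrDl [RHS]addrC.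
  by congr (_ + _); [exact: mulrA|exact: mulrAC].
have chain1 : chain 1.
  rewrite /chain meval_alg1 D1 big1 // => i _.
  by rewrite -mpolyC1 mderivC raddf0 mul0r.
have chainX i : chain (mpolyX k (mnm1 i)).
  rewrite /chain meval_algXU (bigD1 i) //= mderivX mnm1E eqxx scale1r.
  have -> : mnm_sub (mnm1 i) (mnm1 i) = mnm0.
    by apply/mnmP => j; rewrite mnmBE subnn mnm0E.
  rewrite big1 ?addr0 => [|j ji]; first by rewrite mpolyX0 meval_alg1 mul1r.
  by rewrite mderivX mnm1E eq_sym (negPf ji) scale0r raddf0 mul0r.
elim/mpolyind: P => [|c m p _ _ IHp].
  rewrite !raddf0 big1 // => i _; by rewrite !raddf0 mul0r.
rewrite !linearP /= IHp.
have -> : D (meval_alg x (mpolyX k m)) = \sum_i meval_alg x (mderiv i (mpolyX k m)) * D (x i).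
  rewrite -/(chain _) mpolyXE_id; elim/big_ind: _ => // i _.
  by elim: (m i) => [|e IHe]; rewrite ?expr0 ?exprS //; apply: chainM.
rewrite scaler_sumr -big_split; apply: eq_bigr => i _ /=.
by rewrite !linearP /= mulrDl -scalerAl.
Qed.

(** Characteristic 0 enters here: differentiation multiplies the coefficient of m by the exponent
    m_i, which is nonzero in k if it is nonzero. *)
Lemma mderiv_eq0 P : [pchar k] =i pred0 -> (forall i, mderiv i P = 0) ->
  P = mpolyC n (mcoeff mnm0 P).
Proof.
move=> ch0 P0; apply/mpolyP => m; rewrite mcoeffC.
have [->|m0] := eqVneq m mnm0; first by rewrite mulr1.
have [i mi] : exists i, m i != 0%N.
  apply: contra_neqP m0 => m0; apply/mnmP => i; rewrite mnm0E.
  by apply: contrapT => /eqP mi; apply: m0; exists i.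
have := congr1 (mcoeff (mnm_sub m (mnm1 i))) (P0 i); rewrite mcoeff_deriv mcoeff0.
have -> : mnm_add (mnm_sub m (mnm1 i)) (mnm1 i) = m.
  by rewrite submK // lep1mP.
move/eqP; rewrite mulr0 -mulr_natr mulf_eq0 => /orP[/eqP//|].
by move/pcharf0P: ch0 => ->.
Qed.

Lemma msize_mderiv_lt P i : mderiv i P != 0 -> (msize (mderiv i P) < msize P)%N.
Proof.
move=> dP0; rewrite -(mlead_deg dP0).
set m := mlead _; have : mcoeff m (mderiv i P) != 0 by rewrite mleadc_eq0.
rewrite mcoeff_deriv => mP.
have /msize_mdeg_lt : (mnm_add m (mnm1 i)) \in msupp P.
  by rewrite mcoeff_msupp; apply: contraNneq mP => ->; rewrite mul0rn.
by rewrite mdegD mdeg1 addn1.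
Qed.

(* If P has least size among the relations and x_i has greatest weight among the
   variables of P, then D_i turns the relation P into the shorter relation
   given by the i-th partial derivative of P. *)
Lemma triangular_derivations_inj (x : 'I_n -> A) (d : 'I_n -> nat)
    (D : 'I_n -> {linear A -> A}) :
    [pchar k] =i pred0 ->
    (forall i f g, D i (f * g) = f * D i g + D i f * g) ->
    (forall i, D i (x i) = 1) ->
    (forall i j, j != i -> (d j <= d i)%N -> D i (x j) = 0) ->
  forall P, meval_alg x P = 0 -> P = 0.
Proof.
move=> ch0 DM D1 D0 P; have [N] := ubnP (msize P).
elim: N P => // N IHN P; rewrite ltnS => leP P0.
have [[i0 Pi0]|Pc] := pselect (exists i, mderiv i P != 0); last first.
  have PC : P = mpolyC n (mcoeff mnm0 P).
    apply: mderiv_eq0 => // i; apply: contrapT => /eqP Pi; apply: Pc; by exists i.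
  move: P0; rewrite {1}PC /meval_alg mmapC /= => /eqP.
  by rewrite scaler_eq0 oner_eq0 orbF => /eqP c0; rewrite PC c0 mpolyC0.
have [i Pi imax] := @arg_maxnP _ i0 (fun i => mderiv i P != 0) d Pi0.
case/eqP: (Pi); apply: IHN; first exact: leq_trans (msize_mderiv_lt Pi) leP.
have := derivation_meval x P (DM i); rewrite P0 raddf0 (bigD1 i) //= D1 mulr1.
rewrite big1 ?addr0 // => j ji; have [->|Pj] := eqVneq (mderiv j P) 0.
  by rewrite raddf0 mul0r.
by rewrite D0 ?mulr0 //; apply: imax.
Qed.

End Derivations.

(** * Counting generators by derivations at a point *)

Section Generators.
Context {k : fieldType} {A : algType k}.

(** A derivation along [eps] is determined by its values on generators. With fewer than n of them, a
    nonzero combination of the [psi i] would vanish on all generators, hence everywhere, against the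
    duality with [x]. *)
Lemma generators_ge n (s : seq A) (eps : A -> k) (psi : 'I_n -> {scalar A})
    (x : 'I_n -> A) :
    (forall S : {pred A}, subalg_closed S -> {subset s <= S} -> forall f, f \in S) ->
    (forall i f g, psi i (f * g) = eps f * psi i g + psi i f * eps g) ->
    (forall i j, psi i (x j) = (i == j)%:R) -> eps 1 = 1 ->
  (n <= size s)%N.
Proof.
move=> sgen psiM psix eps1; rewrite leqNgt; apply/negP => ltsn.
pose M := \matrix_(i < n, j < size s) psi i s`_j.
have /rowV0Pn[v /sub_kermxP vM v0] : kermx M != 0.
  by rewrite -mxrank_eq0 mxrank_ker subn_eq0 -ltnNge
             (leq_ltn_trans (rank_leq_col M)).
pose S : {pred A} := fun f => \sum_i v 0 i * psi i f == 0.
have psi1 i : psi i 1 = 0.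
  have /eqP := psiM i 1 1.
  by rewrite mulr1 eps1 mul1r mulr1 -subr_eq0 opprD addNKr oppr_eq0 => /eqP.
have cS : subalg_closed S.
  split=> [|a f g /eqP Sf /eqP Sg|f g /eqP Sf /eqP Sg]; apply/eqP.
  - by rewrite big1 // => i _; rewrite psi1 mulr0.
  - transitivity (a * (\sum_i v 0 i * psi i f) + \sum_i v 0 i * psi i g).
      rewrite mulr_sumr -big_split; apply: eq_bigr => i _ /=.
      by rewrite linearP mulrDr mulrCA.
    by rewrite Sf Sg mulr0 addr0.
  transitivity (eps f * (\sum_i v 0 i * psi i g) + (\sum_i v 0 i * psi i f) * eps g).
    rewrite mulr_sumr mulr_suml -big_split; apply: eq_bigr => i _ /=.
    by rewrite psiM mulrDr mulrCA; congr (_ + _); exact: mulrA.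
  by rewrite Sf Sg mulr0 mul0r addr0.
have sS : {subset s <= S}.
  move=> _ /(nthP 0)[j ltj <-]; apply/eqP.
  have /rowP/(_ (Ordinal ltj)) := vM; rewrite !mxE => vMj; rewrite -[RHS]vMj.
  by apply: eq_bigr => i _; rewrite mxE.
case/eqP: v0; apply/rowP => i; rewrite mxE.
have /eqP := sgen S cS sS (x i); rewrite (bigD1 i) //= psix eqxx mulr1 big1 ?addr0 //.
by move=> j ji; rewrite psix (negPf ji) mulr0.
Qed.

End Generators.

(** * Independent families of homogeneous elements *)

Section GoodFamilies.
Context {k : fieldType} {B : bialgType k} (cB : connected_coalg B).
Local Notation F := (coradical_filtration cB).
Local Notation fp := (fil_pred F).
Local Notation K := (gr F).

Lemma gr_mulC : commutative (@GRing.mul K).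
Proof.
move=> f g; move: f; apply: gr_ind => [|f f' Hf Hf'|m x xm].
- by rewrite mulr0 mul0r.
- by rewrite mulrDl mulrDr Hf Hf'.
move: g; apply: gr_ind => [|g g' Hg Hg'|n y yn].
- by rewrite mulr0 mul0r.
- by rewrite mulrDl mulrDr Hg Hg'.
rewrite !grhM // [(n + m)%N]addnC; apply: grh_congr.
  by rewrite addnC filM.
exact: comm_fp.
Qed.

HB.instance Definition _ := GRing.PzRing_hasCommutativeMul.Build K gr_mulC.

(* Equivalently, the symbols of the x_i in gr are linearly independent in
   K+ / (K+)^2, where K+ is the augmentation ideal of gr. *)
Definition good_family n (x : 'I_n -> B) (d : 'I_n -> nat) : Prop :=
  forall i, [/\ (0 < d i)%N, x i \in F (d i) & x i \notin
    lspan2 (decomposables cB (d i)) (lspan [set y | exists2 j, j != i & d j = d i /\ y = x j])].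

Section Family.
Variables (n : nat) (x : 'I_n -> B) (d : 'I_n -> nat).
Hypothesis good : good_family x d.

Definition symbols i : K := grh F (d i) (x i).

Lemma good_gt0 i : (0 < d i)%N. Proof. by case: (good i). Qed.
Lemma good_mem i : x i \in F (d i). Proof. by case: (good i). Qed.

Lemma dual_derivations : exists D : 'I_n -> {linear K -> K}, [/\
  forall i f g, D i (f * g) = f * D i g + D i f * g,
  forall i, D i (symbols i) = 1,
  forall i j, j != i -> (d j <= d i)%N -> D i (symbols j) = 0 &
  forall i j, (d i < d j)%N -> exists2 y, y \in F (d j - d i)%N &
                                D i (symbols j) = grh F (d j - d i)%N y].
Proof.
have H i : exists D : {linear K -> K}, [/\
    forall f g, D (f * g) = f * D g + D f * g,
    D (symbols i) = 1,
    forall j, j != i -> (d j <= d i)%N -> D (symbols j) = 0 &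
    forall j, (d i < d j)%N -> exists2 y, y \in F (d j - d i)%N &
                                D (symbols j) = grh F (d j - d i)%N y].
  have [d0 xd /functional_sep[phi phi0 phix]] := good i.
  have phiQ y : y \in decomposables cB (d i) -> phi y = 0.
    by move=> yQ; apply/phi0/mem_lspan2l.
  exists (graded_derivation phiQ).
  have DE j : graded_derivation phiQ (symbols j) = grh F (d j - d i)%N (coactr phi (x j)).
    by rewrite graded_derivation_hom // good_mem.
  have coF j : coactr phi (x j) \in fp ((d j).+1 - d i).
    by apply: (coactr_fp (infinitesimal_fp phiQ)); apply: good_mem.
  (* In equal degrees the value lies in F_0 = k 1, and the counit reads off the scalar. *)
  have coE j : d j = d i -> coactr phi (x j) = phi (x j) *: 1.
    move=> dji; have := coF j; rewrite dji subSn // subnn.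
    move=> /(coradical_scalar cB)[a aE]; rewrite aE -[phi _]counit_coactr aE.
    by rewrite linearZ /= counit1 mulr1.
  split=> [||j ji|j ltij].
  - exact: graded_derivationM.
  - by rewrite /= DE coE // phix scale1r subnn -gr1E.
  - rewrite leq_eqVlt => /predU1P[dji|ltji]; rewrite /= DE.
      rewrite coE // phi0 ?scale0r ?grh0 //.
      by apply/mem_lspan2r/mem_lspan; exists j.
    have := coF j; rewrite (eqP (ltji : (d j).+1 - d i == 0)%N).
    by rewrite mem_fil_pred0 => /eqP->; rewrite grh0.
  - by exists (coactr phi (x j)); rewrite ?[LHS]DE //; have := coF j; rewrite subSn // ltnW.
have /choice[D DP] := H; exists D.
by split=> [i f g|i|i j|i j]; have [h1 h2 h3 h4] := DP i; [exact: h1|exact: h2|exact: h3|exact: h4].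
Qed.

Lemma symbols_inj (P : mpoly n k) : [pchar k] =i pred0 -> meval_alg symbols P = 0 -> P = 0.
Proof.
move=> ch0; have [D [DM D1 D0 _]] := dual_derivations.
exact: triangular_derivations_inj ch0 DM D1 D0 P.
Qed.

(** The augmentation of K. The degree-0 part is F_0 modulo the zero subspace, so [repr] recovers the
    element exactly. *)
Definition gr_counit (f : K) : k := counit (repr (f 0%N)).

Lemma gr_counit_repr (f : K) y : f 0%N = \pi_(quotm (fp 0)) y -> gr_counit f = counit y.
Proof.
move=> fE; rewrite /gr_counit fE; have := repr_pi_fp F 0 y.
by rewrite mem_fil_pred0 subr_eq0 => /eqP->.
Qed.

Lemma gr_counit_linear : scalar gr_counit.
Proof.
move=> a f g; rewrite (@gr_counit_repr _ (a *: repr (f 0%N) + repr (g 0%N))).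
  by rewrite linearP.
by rewrite linearP /= !reprK.
Qed.

HB.instance Definition _ := GRing.isLinear.Build k K k *%R gr_counit gr_counit_linear.

Lemma gr_counitM f g : gr_counit (f * g) = gr_counit f * gr_counit g.
Proof.
rewrite (@gr_counit_repr _ (repr (f 0%N) * repr (g 0%N))) ?counitM //.
by rewrite /= big_ord1.
Qed.

Lemma gr_counit_grh m y : y \in F m -> gr_counit (grh F m y) = if m == 0%N then counit y else 0.
Proof.
move=> ym; rewrite (@gr_counit_repr _ (if m == 0%N then y else 0)) ?grhE //.
  by case: eqP; rewrite ?raddf0.
by rewrite eq_sym.
Qed.

(** Composed with the augmentation, the triangular system becomes diagonal: the unknown values have
    positive degree and are killed. *)
Lemma good_family_size (s : seq K) :
    (forall S : {pred K}, subalg_closed S -> {subset s <= S} -> forall f, f \in S) ->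
  (n <= size s)%N.
Proof.
move=> sgen; have [D [DM D1 D0 Dgt]] := dual_derivations.
have eps1 : gr_counit 1 = 1.
  by rewrite gr1E gr_counit_grh ?fil1 //= counit1.
apply: (generators_ge (eps := gr_counit) (psi := fun i => gr_counit \o D i)
          (x := symbols) sgen) => //.
  by move=> i f g /=; rewrite DM raddfD /= !gr_counitM.
move=> i j /=; case: (eqVneq i j) => [->|ij]; first by rewrite D1 eps1.
have [ledji|ltij] := leqP (d j) (d i); first by rewrite D0 ?raddf0 // eq_sym.
have [y yF ->] := Dgt _ _ ltij.
by rewrite gr_counit_grh // subn_eq0 leqNgt ltij.
Qed.

Definition monomial_weight (m : multinom n) : nat := (\sum_i m i * d i)%N.

Lemma mdeg_le_weight m : (mdeg m <= monomial_weight m)%N.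
Proof.
by rewrite mdegE leq_sum // => i _; rewrite leq_pmulr ?good_gt0.
Qed.

Lemma grh_exp i e : x i ^+ e \in F (e * d i) /\ grh F (e * d i) (x i ^+ e) = symbols i ^+ e.
Proof.
elim: e => [|e [IHF IHe]]; first by rewrite mul0n !expr0 fil1 -gr1E.
by rewrite mulSn !exprS filM ?good_mem // -grhM ?good_mem // IHe.
Qed.

Lemma grh_monomial m : mmap1 x m \in F (monomial_weight m) /\
  grh F (monomial_weight m) (mmap1 x m) = mmap1 symbols m.
Proof.
rewrite /mmap1 /monomial_weight.
elim/big_rec3: _ => [|i X w Y _ [YF <-]]; first by rewrite fil1 gr1E.
by have [xe <-] := grh_exp i (m i); rewrite filM // grhM.
Qed.

Lemma monomial_mem m : mmap1 x m \in F (monomial_weight m).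
Proof. by case: (grh_monomial m). Qed.

(* Pass to the part of greatest weight and use the independence of the symbols. *)
Lemma ordered_monomials_inj (P : mpoly n k) : [pchar k] =i pred0 ->
  meval_alg x P = 0 -> P = 0.
Proof.
move=> ch0 P0; apply/eqP; rewrite -msupp_eq0; apply: contraT.
case sE: (msupp P) => [//|m0 s] _.
pose w := monomial_weight; pose N := (\max_(m <- msupp P) w m)%N.
have wN m : m \in msupp P -> (w m <= N)%N by move=> mP; apply: leq_bigmax_seq.
have [m1 m1P m1N] : exists2 m, m \in msupp P & w m = N.
  rewrite /N sE; elim: s m0 {sE wN N} => [|m2 r IHr] m0.
    by exists m0; rewrite ?inE // big_seq1.
  rewrite big_cons; have [m mr <-] := IHr m2; rewrite /maxn.
  by case: ifP => _; [exists m|exists m0]; rewrite // inE ?mr ?eqxx ?orbT.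
pose Q : mpoly n k := \sum_(m <- msupp P | w m == N) mcoeff m P *: mpolyX k m.
have Q0 : Q = 0.
  apply: symbols_inj => //; rewrite raddf_sum /=.
  under eq_bigr => m _ do rewrite linearZ /= meval_algX.
  have : grh F N (meval_alg x P) = 0 by rewrite P0 grh0.
  (* [grh_sum] asks every term to lie in F N, also outside the support; hence the value 0 there. *)
  pose y m := if m \in msupp P then mmap1 x m else 0.
  have yF m : y m \in F N.
    rewrite /y; case: ifP => [mP|_]; last exact: rpred0.
    exact: F_leq (wN m mP) _ (monomial_mem m).
  rewrite meval_algE (eq_big_seq (fun m => mcoeff m P *: y m)); last first.
    by move=> m mP; rewrite /y mP.
  rewrite grh_sum // => E; rewrite -[RHS]E [LHS]big_mkcond /=.
  apply: eq_big_seq => m mP; rewrite /y mP; case: eqP => [<-|/eqP wm].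
    by have [_ ->] := grh_monomial m.
  rewrite grh_eq0 ?scaler0 //; apply: (@fp_leq _ _ cB (w m).+1) (monomial_mem m).
  by rewrite ltn_neqAle wm wN.
have := congr1 (mcoeff m1) Q0; rewrite mcoeff0 raddf_sum /= -big_filter.
rewrite (bigD1_seq m1) ?filter_uniq ?msupp_uniq ?mem_filter ?m1N ?eqxx //=.
rewrite mcoeffZ mcoeffX eqxx mulr1 big1 => [|m mm1]; last first.
  by rewrite mcoeffZ mcoeffX (negPf mm1) mulr0.
by move/eqP; rewrite addr0 mcoeff_eq0 m1P.
Qed.

(** Exchange: if an old member became dependent, [y] would occur in the relation with a coefficient
    a != 0, and solving for [y] contradicts its independence. *)
Lemma good_family_cons y e : (0 < e)%N -> y \in F e ->
    y \notin lspan2 (decomposables cB e) (lspan [set z | exists2 j, d j = e & z = x j]) ->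
  good_family (fun i : 'I_n.+1 => oapp x y (unlift ord0 i))
              (fun i : 'I_n.+1 => oapp d e (unlift ord0 i)).
Proof.
move=> e0 ye yN i; case: (unliftP ord0 i) => [i' ->|->]; last first.
  rewrite /=; split=> //; apply: contraNN yN.
  apply: lspan_sub => z [zQ|zL]; first exact: mem_lspan2l.
  apply: mem_lspan2r; move: zL; apply: lspan_sub => _ [j j0 [dj ->]].
  case: (unliftP ord0 j) j0 dj => [j' ->|->]; last by rewrite eqxx.
  by rewrite /= => _ dj; apply: mem_lspan; exists j'.
rewrite /=; have [di xi xN] := good i'; split=> //.
apply: contraNN xN => /lspan2P[q qQ].
pose L := lspan [set z | exists2 j, j != i' & d j = d i' /\ z = x j].
have [die|die] := eqVneq (d i') e; last first.
  move=> xq; apply/lspan2P; exists q => //; move: xq.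
  apply: lspan_sub => _ [j ji [dj ->]].
  case: (unliftP ord0 j) ji dj => [j' ->|->]; last first.
    by rewrite /= => _ de; rewrite de eqxx in die.
  rewrite /= (inj_eq lift_inj) => ji dj.
  by apply: mem_lspan; exists j'.
move=> xq; have : exists a, x i' - q - a *: y \in L.
  move: (x i' - q) xq; apply: lspan_ind => [|a u v [b ub] [c vc]|z].
  - by exists 0; rewrite scale0r subrr rpred0.
  - exists (a * b + c); rewrite scalerDl opprD addrACA -scalerA -scalerBr.
    by rewrite rpredD ?rpredZ.
  move=> [j ji [dj ->]]; case: (unliftP ord0 j) ji dj => [j' ->|->]; last first.
    by rewrite /= => _ _; exists 1; rewrite scale1r subrr rpred0.
  rewrite /= (inj_eq lift_inj) => ji dj; exists 0; rewrite scale0r subr0.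
  by apply: mem_lspan; exists j'.
move=> [a aL]; have [a0|a0] := eqVneq a 0.
  by apply/lspan2P; exists q => //; move: aL; rewrite a0 scale0r subr0.
case/negP: yN; have -> : y = a^-1 *: (x i' - q - (x i' - q - a *: y)).
  by rewrite opprB addrC subrK scalerA mulVf ?scale1r.
rewrite rpredZ // -addrA rpredD //.
  by apply/mem_lspan2r/mem_lspan; exists i'.
rewrite -opprD rpredN rpredD //; first by apply/mem_lspan2l; rewrite -die.
apply: mem_lspan2r; move: aL; apply: lspan_sub => _ [j _ [dj ->]].
by apply: mem_lspan; exists j => //; rewrite dj.
Qed.

Section Maximal.
Hypothesis maxl : forall e y, (0 < e)%N -> y \in F e ->
  y \in lspan2 (decomposables cB e) (lspan [set z | exists2 j, d j = e & z = x j]).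

Lemma symbols_generate_hom e y : y \in F e ->
  exists P : mpoly n k, grh F e y = meval_alg symbols P.
Proof.
have [N] := ubnP e; elim: N => // N IHN in e y *; rewrite ltnS => leN ye.
have [e0|e0] := posnP e.
  move: ye; rewrite e0 => /(coradical_scalar cB)[a ->].
  exists (a *: 1); rewrite linearZ /= meval_alg1 gr1E.
  by rewrite -[a *: 1]addr0 grh_linear ?fil1 ?rpred0 // grh0 addr0.
(* Membership in F e is carried along because [grh] is linear only there; outside F e it takes the
   value 0. *)
pose good_elt z := z \in F e /\ exists P : mpoly n k, grh F e z = meval_alg symbols P.
suff [] : good_elt y by [].
have lin a u v : good_elt u -> good_elt v -> good_elt (a *: u + v).
  move=> [uF [P uP]] [vF [Q vQ]]; split; first by rewrite rpredD ?rpredZ.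
  by exists (a *: P + Q); rewrite grh_linear // uP vQ linearP.
have zer : good_elt 0 by split; [exact: rpred0|exists 0; rewrite grh0 raddf0].
move: (maxl e0 ye); clear ye; move: y; apply: lspan_ind => // z [|].
  move: z; apply: lspan_ind => // z [ze|[i [j [a [b [/andP[i0 j0] ije ai bj ->]]]]]].
    split; first exact: fil_predW.
    by exists 0; rewrite grh_eq0 // raddf0.
  have [|P aP] := IHN i a _ ai.
    by rewrite (leq_trans _ leN) // -ije -[X in (X < _)%N]addn0 ltn_add2l.
  have [|Q bQ] := IHN j b _ bj.
    by rewrite (leq_trans _ leN) // -ije -[X in (X < _)%N]add0n ltn_add2r.
  split; first by rewrite -ije filM.
  by exists (P * Q); rewrite -ije -grhM // aP bQ meval_algM.
move: z; apply: lspan_ind => // _ [j dj ->].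
split; first by rewrite -dj good_mem.
by exists (mpolyX k (mnm1 j)); rewrite meval_algXU /symbols dj.
Qed.

Lemma symbols_generate (f : K) : exists P : mpoly n k, f = meval_alg symbols P.
Proof.
move: f; apply: gr_ind => [|f g [P ->] [Q ->]|e y /symbols_generate_hom//].
  by exists 0; rewrite raddf0.
by exists (P + Q); rewrite raddfD.
Qed.

(** A polynomial expression of the class of [y], lifted to ordered monomials in B, agrees with [y]
    up to an element of lower degree, to which induction applies. *)
Lemma F_sub_monomials e y : y \in fp e ->
  y \in lspan [set z | exists2 m, (monomial_weight m < e)%N & z = mmap1 x m].
Proof.
elim: e y => [|e IHe] y ye.
  by move: ye; rewrite mem_fil_pred0 => /eqP->; rewrite rpred0.
have [P /(congr1 (fun f : K => f e))] := symbols_generate (grh F e y).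
rewrite grhE // eqxx meval_algE gr_sumE.
(* Only the monomials of weight e contribute to the component of degree e. *)
pose z m := if monomial_weight m == e then mmap1 x m else 0.
have -> : \sum_(m <- msupp P) (mcoeff m P *: mmap1 symbols m : K) e =
          \pi_(quotm (fp e)) (\sum_(m <- msupp P) mcoeff m P *: z m).
  rewrite raddf_sum; apply: eq_bigr => m _ /=; rewrite linearZ; congr (_ *: _).
  have [mF <-] := grh_monomial m; rewrite grhE // /z eq_sym.
  by case: eqP.
move=> /eqP; rewrite quotm_eq => /IHe yz.
rewrite -[y](subrK (\sum_(m <- msupp P) mcoeff m P *: z m)) rpredD //.
  by move: yz; apply: lspan_sub => _ [m lt ->]; apply: mem_lspan; exists m => //; apply: ltnW.
rewrite rpred_sum // => m _; rewrite rpredZ // /z; case: eqP => [me|_]; last exact: rpred0.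
by apply: mem_lspan; exists m; rewrite ?me.
Qed.

End Maximal.

End Family.

Lemma maximal_good_family N :
    (forall n (x : 'I_n -> B) d, good_family x d -> (n <= N)%N) ->
  exists n (x : 'I_n -> B) d, good_family x d /\ forall e y, (0 < e)%N -> y \in F e ->
    y \in lspan2 (decomposables cB e) (lspan [set z | exists2 j, d j = e & z = x j]).
Proof.
move=> bd; pose P n : bool := `[< exists (x : 'I_n -> B) d, good_family x d >].
have P0 : exists n, P n.
  by exists 0%N; apply/asboolP; exists (fun=> 0), (fun=> 0%N) => -[].
have PN n : P n -> (n <= N)%N by move=> /asboolP[x [d /bd]].
have [n /asboolP[x [d xd]] nmax] := ex_maxnP P0 PN.
exists n, x, d; split=> // e y e0 ye; apply: contraT => yN.
suff /nmax : P n.+1 by rewrite ltnn.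
by apply/asboolP; eexists; eexists; apply: good_family_cons yN.
Qed.

End GoodFamilies.

(** * Gelfand-Kirillov dimension *)

Section GrowthRates.
Context {R : realType}.
Import numFieldNormedType.Exports.
Local Open Scope classical_set_scope.

Lemma le_limn_esup (u v : (\bar R)^nat) N :
  (forall q, (N <= q)%N -> (u q <= v q)%E) -> (limn_esup u <= limn_esup v)%E.
Proof.
move=> uv; rewrite !limn_esup_lim; apply: lee_lim; [exact: is_cvg_esups|exact: is_cvg_esups|].
exists N => // p /= Np; apply: ge_ereal_sup => _ [q /= pq <-].
apply: le_trans (uv q (leq_trans Np pq)) _; apply: ereal_sup_ubound.
by exists q.
Qed.

Lemma cvg_inv_ln : (fun q : nat => (ln (q%:R : R))^-1) @ \oo --> (0 : R).
Proof.
apply/gtr0_cvgV0.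
  by exists 2%N => // q /= q2; rewrite ln_gt0 // ltr1n.
apply/cvgryPge => a; have := nbhs_infty_ger (expR a); apply: filterS => q aq.
by rewrite -[a]expRK ler_ln // posrE ?expR_gt0 // (lt_le_trans (expR_gt0 a)).
Qed.

(** The model for both growth bounds: the logarithm of a constant times q^n is n ln q + c. *)
Lemma limn_esup_log n (c : R) :
  limn_esup (fun q : nat => (n%:R + c / ln (q%:R : R))%:E) = n%:R%:E.
Proof.
apply: (cvg_limn_einf_sup _).2; apply: cvg_EFin; first exact: nearW.
rewrite -[X in _ --> X]addr0 -[X in _ + X](mulr0 c).
by apply: cvgD; [exact: cvg_cst|apply: cvgMr; exact: cvg_inv_ln].
Qed.

(** The constant -n ln n of the comparison comes from q < n (q %/ n + 1). From q = 2 on, the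
    denominator ln q is positive. *)
Lemma limn_esup_ge_growth n (g : nat -> nat) :
  (forall q, ((q %/ n).+1 ^ n <= g q)%N) ->
  (n%:R%:E <= limn_esup (fun q => (ln ((g q)%:R : R) / ln q%:R)%:E))%E.
Proof.
move=> gn; rewrite -(limn_esup_log n (- (n%:R * ln n%:R))).
apply: (@le_limn_esup _ _ 2%N) => q q2; rewrite lee_fin.
have lnq : 0 < ln (q%:R : R) by rewrite ln_gt0 // ltr1n.
rewrite ler_pdivlMr // mulrDl divfK ?gt_eqF // -mulrBr.
have [->|n0] := posnP n.
  by rewrite mul0r ln_ge0 // ler1n (leq_trans _ (gn q)) // expn_gt0.
have q0 : (0 < q)%N by apply: leq_trans q2.
apply: (@le_trans _ _ (n%:R * ln ((q %/ n).+1%:R : R))).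
  rewrite ler_wpM2l // lerBlDr -lnM ?posrE ?ltr0n //.
  rewrite ler_ln ?posrE ?mulr_gt0 ?ltr0n // -natrM ler_nat.
  by rewrite ltnW // -ltn_divLR.
rewrite mulr_natl -lnXn ?ltr0n // -natrX ler_ln ?posrE ?ltr0n ?expn_gt0 ?ler_nat //.
by rewrite (leq_trans _ (gn q)) // expn_gt0.
Qed.

Lemma limn_esup_le_growth n C (g : nat -> nat) : (0 < C)%N ->
  (forall q, (0 < q)%N -> (g q <= (C * q) ^ n)%N) ->
  (limn_esup (fun q => (ln ((g q)%:R : R) / ln q%:R)%:E) <= n%:R%:E)%E.
Proof.
move=> C0 gn; rewrite -(limn_esup_log n (n%:R * ln C%:R)).
apply: (@le_limn_esup _ _ 2%N) => q q2; rewrite lee_fin.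
have lnq : 0 < ln (q%:R : R) by rewrite ln_gt0 // ltr1n.
have q0 : (0 < q)%N by apply: leq_trans q2.
rewrite ler_pdivrMr // mulrDl divfK ?gt_eqF // addrC -mulrDr -lnM ?posrE ?ltr0n //.
rewrite -natrM mulr_natl -lnXn ?ltr0n ?muln_gt0 ?C0 // -natrX.
have Cq : (0 < (C * q) ^ n)%N by rewrite expn_gt0 muln_gt0 C0 q0.
(* [ln 0] is 0 by convention, so a vanishing [g q] respects the bound. *)
have [->|g0] := posnP (g q).
  by rewrite ln0 // ln_ge0 // ler1n.
by rewrite ler_ln ?posrE ?ltr0n ?ler_nat // gn.
Qed.

End GrowthRates.

(** * Growth of subspaces and counting of monomials *)

Section SpannedFamilies.
Context {k : fieldType}.

Lemma spanned_fin (V : lmodType k) (I : finType) (e : I -> V) (W : {pred V}) :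
  (forall v, v \in W -> v \in lspan [set x | exists i, x = e i]) -> spanned W #|I|.
Proof.
move=> We; exists (fun i => e (enum_val i)) => v /We vE; apply/famspanP.
move: v vE; apply: lspan_sub => _ [i ->]; apply: mem_lspan.
by exists (enum_rank i); rewrite enum_rankK.
Qed.

Context {A : algType k}.
Implicit Types V W X : subspace A.

Lemma mulv_spanned (V W : {pred A}) r s : spanned V r -> spanned W s ->
  exists t, spanned (mulv V W) t.
Proof.
move=> [e eV] [f fW]; exists #|{: 'I_r * 'I_s}|.
apply: (spanned_fin (e := fun p => e p.1 * f p.2)) => v.
apply: lspan_sub => _ [x [y [/eV[c ->] /fW[d ->] ->]]].
rewrite mulr_suml rpred_sum // => i _; rewrite mulr_sumr rpred_sum // => j _.
by rewrite -scalerAl -scalerAr !rpredZ // mem_lspan //; exists (i, j).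
Qed.

Lemma expv_spanned V r q : spanned V r -> exists t, spanned (expv V q) t.
Proof.
move=> sV; elim: q => [|q [t IHq]] /=; last exact: mulv_spanned IHq sV.
exists 1%N; exists (fun=> 1) => v vE; apply/famspanP.
by move: v vE; apply: lspan_sub => _ ->; apply: mem_lspan; exists ord0.
Qed.

Lemma growth_spanned V r q : spanned V r -> exists t, spanned (growth V q) t.
Proof.
move=> sV; have /choice[t tP] i := expv_spanned i sV.
pose e i := sval (cid (tP i)); have eP i := svalP (cid (tP i)).
exists #|{: {i : 'I_q.+1 & 'I_(t i)}}|.
apply: (spanned_fin (e := fun p : {i : 'I_q.+1 & 'I_(t i)} => e (tag p) (tagged p))) => v.
apply: lspan_sub => x [i iq /eP[c ->]].
rewrite rpred_sum // => j _; rewrite rpredZ // mem_lspan //.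
by exists (Tagged (fun i : 'I_q.+1 => 'I_(t i)) (j : 'I_(t (Ordinal (iq : (i < q.+1)%N))))).
Qed.

Lemma growth_has_dim V d q : has_dim V d -> has_dim (growth V q) (dimv (growth V q)).
Proof.
move=> /has_dim_spanned sV; have [t st] := growth_spanned q sV.
by have [e _ eP] := spanned_has_dim st; rewrite (dimvE eP).
Qed.

Lemma expvD V a b u v : u \in expv V a -> v \in expv V b -> u * v \in expv V (a + b).
Proof.
move=> ua; elim: b v => [|b IHb] v; rewrite ?addn0 ?addnS.
  move: v; apply: lspan_ind => [|c x y ux uy|_ ->]; rewrite ?mulr0 ?rpred0 ?mulr1 //.
  by rewrite mulrDr -scalerAr rpredD ?rpredZ.
move: v; apply: lspan_ind => [|c x y ux uy|_ [x [y [xb yV ->]]]].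
- by rewrite mulr0 rpred0.
- by rewrite mulrDr -scalerAr rpredD ?rpredZ.
by rewrite mulrA; apply: mem_lspan; exists (u * x), y; rewrite IHb.
Qed.

Lemma monomial_expv V n (x : 'I_n -> A) m :
  (forall i, x i \in V) -> mmap1 x m \in expv V (mdeg m).
Proof.
move=> xV; have one : 1 \in expv V 0 by apply: mem_lspan.
have ex i e : x i ^+ e \in expv V e.
  elim: e => [|e IHe]; first by rewrite expr0.
  by rewrite exprSr; apply: mem_lspan; exists (x i ^+ e), (x i).
rewrite /mmap1 mdegE; elim/big_rec2: _ => // i w X _ Xw.
exact: expvD.
Qed.

Definition monomials_le n (x : 'I_n -> A) N : set A :=
  [set z | exists2 m, (mdeg m <= N)%N & z = mmap1 x m].

(** A crude count that only uses that each exponent is at most N; it has the right order of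
    growth. *)
Lemma monomials_le_spanned n (x : 'I_n -> A) N :
  spanned (lspan (monomials_le x N)) (N.+1 ^ n).
Proof.
have -> : (N.+1 ^ n)%N = #|{: {ffun 'I_n -> 'I_N.+1}}| by rewrite card_ffun !card_ord.
pose mon (f : {ffun 'I_n -> 'I_N.+1}) : multinom n := Multinom [tuple (f i : nat) | i < n].
apply: (spanned_fin (e := fun f => mmap1 x (mon f))) => v.
apply: lspan_sub => _ [m mN ->]; apply: mem_lspan.
exists [ffun i => inord (m i)]; congr (mmap1 x _); apply/mnmP => i.
rewrite mnmE ffunE inordK // ltnS (leq_trans _ mN) // mdegE.
by rewrite (bigD1 i) //= leq_addr.
Qed.

Lemma GKdim_ge (R : realType) n (x : 'I_n -> A) :
  (forall P : mpoly n k, meval_alg x P = 0 -> P = 0) -> (n%:R%:E <= GKdim R A)%E.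
Proof.
move=> xI; pose V := famspan x.
have [d _ Vd] : exists2 d, (d <= n)%N & has_dim V d.
  by apply: spanned_has_dim; exists x => v /famspanP.
apply: (@le_trans _ _ (limn_esup (fun q => (ln (dimv (growth V q))%:R / ln q%:R)%:E))).
  (* With every exponent at most q / n, the total degree stays within q. *)
  apply: limn_esup_ge_growth => q; set m := (q %/ n)%N.
  have -> : (m.+1 ^ n)%N = #|{: {ffun 'I_n -> 'I_m.+1}}| by rewrite card_ffun !card_ord.
  pose mon (f : {ffun 'I_n -> 'I_m.+1}) : multinom n := Multinom [tuple (f i : nat) | i < n].
  have mon_inj : injective mon.
    move=> f g /mnmP fg; apply/ffunP => i; apply: val_inj.
    by have := fg i; rewrite !mnmE.
  apply: (has_dim_le (growth_has_dim q Vd) (b := fun i => mmap1 x (mon (enum_val i)))).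
    move=> c c0 i; pose P : mpoly n k := \sum_i c i *: mpolyX k (mon (enum_val i)).
    have P0 : P = 0.
      apply: xI; rewrite raddf_sum -[RHS]c0; apply: eq_bigr => j _ /=.
      by rewrite linearZ /= meval_algX.
    have := congr1 (mcoeff (mon (enum_val i))) P0; rewrite mcoeff0 raddf_sum /=.
    rewrite (bigD1 i) //= mcoeffZ mcoeffX eqxx mulr1 big1 ?addr0 // => j ji.
    by rewrite mcoeffZ mcoeffX (inj_eq mon_inj) (inj_eq enum_val_inj) (negPf ji) mulr0.
  move=> i; apply: mem_lspan; exists (mdeg (mon (enum_val i))).
    rewrite mdegE (@leq_trans (\sum_(i < n) m)) //.
      by apply: leq_sum => j _; rewrite mnmE -ltnS.
    by rewrite sum_nat_const card_ord mulnC leq_trunc_div.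
  by apply: monomial_expv => j; apply: mem_lspan; exists j.
apply: ereal_sup_ubound; exists V => //; by exists d.
Qed.

(** A finite-dimensional V lies in some G p, so its q-th growth space lies in G (p q), which is
    spanned by at most (p q + 1)^n monomials. *)
Lemma GKdim_le (R : realType) n (x : 'I_n -> A) (G : nat -> subspace A) :
    1 \in G 0%N -> (forall i j, (i <= j)%N -> {subset G i <= G j}) ->
    (forall i j a b, a \in G i -> b \in G j -> a * b \in G (i + j)%N) ->
    (forall a, exists i, a \in G i) ->
    (forall N, {subset G N <= lspan (monomials_le x N)}) ->
  (GKdim R A <= n%:R%:E)%E.
Proof.
move=> G1 Gle GM Gex Gx; apply: ge_ereal_sup => _ [V [d Vd] <-].
have [p Vp] : exists p, {subset V <= G p}.
  have [e [_ eV]] := Vd; have /choice[p pP] i := Gex (e i).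
  exists (\max_i p i)%N => v /eV[c ->]; rewrite rpred_sum // => i _.
  by rewrite rpredZ // (Gle (p i)) // leq_bigmax.
have expG q : {subset expv V q <= G (p * q)%N}.
  elim: q => [|q IHq]; first by rewrite muln0; apply: lspan_sub => _ ->.
  apply: lspan_sub => _ [a [b [aq bV ->]]].
  by rewrite mulnS addnC GM ?IHq ?Vp.
have growG q : {subset growth V q <= G (p * q)%N}.
  apply: lspan_sub => a [i iq ai]; apply: (Gle (p * i)%N); last exact: expG.
  by rewrite leq_mul2l iq orbT.
(* The constant works because p q + 1 <= (p + 1) q once q > 0. *)
apply: (limn_esup_le_growth (C := p.+1)) => // q q0.
have sp : spanned (growth V q) ((p * q).+1 ^ n).
  have [e eP] := monomials_le_spanned x (p * q); exists e => v vq.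
  by apply/eP/Gx/growG.
apply: leq_trans (has_dim_ge sp (growth_has_dim q Vd)) _.
case: (n) => [//|l]; rewrite leq_exp2r // mulSn addnC -addn1 leq_add2l //.
Qed.

End SpannedFamilies.

(** * Equivalence of the four conditions *)

Section PolynomialIso.
Context {k : fieldType}.

Lemma finitely_generated_iso (A : algType k) l :
  algebra_iso A (mpoly l k) -> finitely_generated A.
Proof.
move=> [f [g fK gK]]; exists [seq g (mpolyX k (mnm1 i)) | i <- enum 'I_l].
move=> S cS sS a; have [S1 SD SM] := cS; rewrite -[a]fK; move: (f a) => P.
have gD b Q Q' : g (b *: Q + Q') = b *: g Q + g Q'.
  by apply: (can_inj fK); rewrite raddfD /= linearZ /= !gK.
have gM Q Q' : g (Q * Q') = g Q * g Q'.
  by apply: (can_inj fK); rewrite rmorphM /= !gK.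
have g1 : g 1 = 1 by apply: (can_inj fK); rewrite gK rmorph1.
have g0 : g 0 = 0 by apply: (can_inj fK); rewrite gK rmorph0.
have S0 : 0 \in S by have := SD (-1) 1 1 S1 S1; rewrite scaleN1r addNr.
elim/mpolyind: P => [|c m P _ _ IHP]; first by rewrite g0.
rewrite gD SD //.
rewrite mpolyXE_id; elim/big_ind: _ => [|Q Q' QS QS'|i _]; rewrite ?g1 // ?gM ?SM //.
elim: (m i) => [|e IHe]; first by rewrite expr0 g1.
by rewrite exprS gM SM // sS // map_f ?mem_enum.
Qed.

Lemma algebra_iso_mpoly (A : comAlgType k) n (x : 'I_n -> A) :
    (forall P : mpoly n k, meval_alg x P = 0 -> P = 0) ->
    (forall a, exists P : mpoly n k, a = meval_alg x P) ->
  algebra_iso A (mpoly n k).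
Proof.
move=> xI /choice[g gP].
have xinj : injective (meval_alg x).
  by move=> P Q PQ; apply/eqP; rewrite -subr_eq0; apply/eqP/xI; rewrite raddfB /= PQ subrr.
have gK : cancel (meval_alg x) g by move=> P; apply: xinj; rewrite -gP.
have gL : linear g by move=> a f h; apply: xinj; rewrite linearP /= -!gP.
have gM : monoid_morphism g.
  split=> [|f h]; apply: xinj; first by rewrite -gP meval_alg1.
  by rewrite meval_algM -!gP.
pose G := HB.pack_for {lrmorphism A -> mpoly n k} g
  (GRing.isLinear.Build k A (mpoly n k) *:%R g gL)
  (GRing.isMonoidMorphism.Build A (mpoly n k) g gM).
by exists G; exists (meval_alg x) => // f; rewrite -gP.
Qed.

Lemma GKdim_le_generated (R : realType) (A : comAlgType k) n (x : 'I_n -> A) :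
  (forall a, exists P : mpoly n k, a = meval_alg x P) -> (GKdim R A <= n%:R%:E)%E.
Proof.
move=> xG; apply: (GKdim_le R (x := x) (G := fun N => lspan (monomials_le x N))) => //.
- by apply: mem_lspan; exists mnm0; rewrite ?mdeg0 ?mmap11.
- move=> i j ij; apply: lspan_sub => _ [m mi ->]; apply: mem_lspan.
  by exists m => //; apply: leq_trans mi ij.
- move=> i j a b; move: a; apply: lspan_ind => [|c a a' IHa IHa' bj|_ [m mi ->]].
  + by rewrite mul0r rpred0.
  + by rewrite mulrDl -scalerAl rpredD ?rpredZ ?IHa ?IHa'.
  move: b; apply: lspan_ind => [|c b b' IHb IHb'|_ [m' mj ->]].
  + by rewrite mulr0 rpred0.
  + by rewrite mulrDr -scalerAr rpredD ?rpredZ.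
  apply: mem_lspan; exists (mnm_add m m'); first by rewrite mdegD leq_add.
  by rewrite commr_mmap1_M // => l y; apply: mulrC.
- move=> a; have [P ->] := xG a; exists (msize P).
  rewrite meval_algE big_seq rpred_sum // => m mP; rewrite rpredZ // mem_lspan //.
  by exists m => //; apply/ltnW/msize_mdeg_lt.
- by move=> N.
Qed.

End PolynomialIso.

Lemma bounded_of_lt_pinfty (R : realType) (y : \bar R) : (y < +oo)%E ->
  exists N, forall n, (n%:R%:E <= y)%E -> (n <= N)%N.
Proof.
case: y => [r _|//|_]; last by exists 0%N => n; rewrite leeNy_eq.
exists (Num.bound r) => n; rewrite lee_fin => nr.
rewrite -(ler_nat R) (le_trans nr) // ltW // archi_boundP //.
exact: le_trans nr.
Qed.

Section Equivalence.
Context (R : realType) {k : fieldType} {B : bialgType k} (cB : connected_coalg B).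
Hypothesis ch0 : [pchar k] =i pred0.
Local Notation F := (coradical_filtration cB).

(** The hub of the equivalence: each of the four conditions yields this bound, and the bound yields
    them all. *)
Definition good_families_bounded : Prop :=
  exists N, forall n (x : 'I_n -> B) d, good_family cB x d -> (n <= N)%N.

Lemma bounded_of_GKdim : (GKdim R B < +oo)%E -> good_families_bounded.
Proof.
move=> /bounded_of_lt_pinfty[N NP]; exists N => n x d good; apply: NP.
by apply: (GKdim_ge R (x := x)) => P; exact: (ordered_monomials_inj good ch0).
Qed.

Lemma bounded_of_GKdim_gr : (GKdim R (gr F) < +oo)%E -> good_families_bounded.
Proof.
move=> /bounded_of_lt_pinfty[N NP]; exists N => n x d good; apply: NP.
by apply: (GKdim_ge R (x := symbols cB x d)) => P; exact: (symbols_inj good ch0).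
Qed.

Lemma bounded_of_finitely_generated : finitely_generated (gr F) -> good_families_bounded.
Proof.
move=> [s sP]; exists (size s) => n x d good.
by apply: (good_family_size good) => S cS sS f; apply: sP.
Qed.

Lemma bounded_structure : good_families_bounded ->
  exists n, [/\ GKdim R B = n%:R%:E, GKdim R (gr F) = n%:R%:E &
                algebra_iso (gr F) (mpoly n k)].
Proof.
move=> [N /maximal_good_family[n [x [d [good maxl]]]]]; exists n.
have gen := symbols_generate good maxl.
have inj P := symbols_inj good (P := P) ch0.
split; last exact: algebra_iso_mpoly inj gen.
  apply/eqP; rewrite eq_le; apply/andP; split.
    (* B need not be commutative, so the degree in the [x i] need not give a multiplicative
       filtration; F does, and the degree of a monomial is at most its weight. *)
    apply: (GKdim_le R (x := x) (G := F)).
    - exact: coradical_fil1.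
    - exact: F_leq.
    - by move=> i j a b ai bj; apply: coradical_filM.
    - exact: coradical_fil_exhaustive.
    move=> M y yM; have := F_sub_monomials good maxl (yM : y \in fil_pred F M.+1).
    apply: lspan_sub => _ [m mM ->]; apply: mem_lspan; exists m => //.
    exact: leq_trans (mdeg_le_weight good m) mM.
  by apply: (GKdim_ge R (x := x)) => P; exact: (ordered_monomials_inj good ch0).
apply/eqP; rewrite eq_le; apply/andP; split.
  exact: GKdim_le_generated gen.
exact: GKdim_ge inj.
Qed.

End Equivalence.

Theorem theorem6p10 (R : realType) (k : closedFieldType)
    (char0 : [pchar k]%R =i pred0)
    (H : hopfAlgType k) (cH : connected_coalg H) :
  [<-> (GKdim R H < +oo)%E;
       (GKdim R (gr (coradical_filtration cH)) < +oo)%E;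
       finitely_generated (gr (coradical_filtration cH));
       exists l : nat,
         algebra_iso (gr (coradical_filtration cH)) (mpoly l k)]
  /\ ((GKdim R H < +oo)%E ->
      GKdim R H = GKdim R (gr (coradical_filtration cH)) /\
      exists d : nat, GKdim R H = (d%:R)%:E).
Proof.
have bs := bounded_structure R char0 (cB := cH).
split.
  tfae.
  - by move=> /(bounded_of_GKdim cH char0)/bs[n [_ -> _]]; rewrite ltry.
  - move=> /(bounded_of_GKdim_gr char0)/bs[n [_ _]]; exact: finitely_generated_iso.
  - by move=> /bounded_of_finitely_generated/bs[n [_ _ iso]]; exists n.
  - move=> [l /finitely_generated_iso/bounded_of_finitely_generated/bs[n [-> _ _]]].
    by rewrite ltry.
move=> /(bounded_of_GKdim cH char0)/bs[n [-> -> _]]; split=> //; by exists n.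
Qed.
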